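(* Let $M\in\mathbb{N}$, let $\Theta=\bigcup_{n\in\mathbb{N}}\mathbb{Z}^n$, let $A$ be a finite nonempty set, let $\kappa\in[0,\infty)$, let $\mathfrak{D}$ be a nonempty set, let $\lambda_d,L_d,\mathfrak{R}_d\in[0,\infty)$, $d\in\mathfrak{D}$, let $(\Omega,\mathcal{F},\mathbb{P})$ be a probability space, and let $(\mathbb{X}_d,\mathcal{X}_d)$, $d\in\mathfrak{D}$, be nonempty measurable spaces. For every $d\in\mathfrak{D}$ let $\mathfrak{w}_d\colon\mathbb{X}_d\to(0,\infty)$ be $\mathcal{X}_d/\mathcal{B}((0,\infty))$-measurable, let $f_d\colon\mathbb{X}_d\times\mathbb{R}^A\to\mathbb{R}$ be $(\mathcal{X}_d\otimes(\bigotimes_{a\in A}\mathcal{B}(\mathbb{R})))/\mathcal{B}(\mathbb{R})$-measurable, let $(\mathcal{F}_d^\theta)_{\theta\in\Theta}$ be independent sub-$\sigma$-algebras of $\mathcal{F}$, and let $X_d^\theta\colon\mathbb{X}_d\times\Omega\to\mathbb{X}_d^A$, $\theta\in\Theta$, be i.i.d. random fields such that for all $\theta\in\Theta$, $X_d^\theta$ is $(\mathcal{X}_d\otimes\mathcal{F}_d^\theta)/(\bigotimes_{a\in A}\mathcal{X}_d)$-measurable. Assume for all $d\in\mathfrak{D}$, $(x,a)\in\mathbb{X}_d\times A$, $r,s\in\mathbb{R}^A$ that $|f_d(x,r)-f_d(x,s)|\le L_d\max_{b\in A}|r(b)-s(b)|$, $(\mathbb{E}[|f_d(X_d^{0,x,a},0)|^2])^{1/2}\le\kappa\,\mathfrak{w}_d(x)$,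 $(\mathbb{E}[|\mathfrak{w}_d(X_d^{0,x,a})|^2])^{1/2}\le\lambda_d\mathfrak{w}_d(x)$, and $\sup_{u\in\mathfrak{D}}\lambda_uL_u<1$. Assume $$M>\frac{\big(1+(\sup_{d\in\mathfrak{D}}\lambda_dL_d)(2|A|-1)\big)^2}{\big(1-(\sup_{d\in\mathfrak{D}}\lambda_dL_d)\big)^2}.$$ For every $d\in\mathfrak{D}$ let $V_{n,d}^\theta\colon\mathbb{X}_d\times\Omega\to\mathbb{R}^A$, $n\in\mathbb{N}_0$, $\theta\in\Theta$, satisfy for all $n\in\mathbb{N}_0$, $(x,a)\in\mathbb{X}_d\times A$, $\theta\in\Theta$ that $$\big(V_{n,d}^\theta(x)\big)(a)=\sum_{l=0}^{n-1}\frac{1}{M^{n-l}}\sum_{i=1}^{M^{n-l}}\Big[f_d\big(X_d^{(\theta,l,i),x,a},V_{l,d}^{(\theta,l,i)}(X_d^{(\theta,l,i),x,a})\big)-\mathbf{1}_{\mathbb{N}}(l)f_d\big(X_d^{(\theta,l,i),x,a},V_{\max\{l-1,0\},d}^{(\theta,-l,i)}(X_d^{(\theta,l,i),x,a})\big)\Big],$$ and let $\mathfrak{C}_{n,d}\in[0,\infty)$, $n\in\mathbb{N}_0$, $d\in\mathfrak{D}$, satisfy for all $n\in\mathbb{N}_0$, $d\in\mathfrak{D}$ that $$\mathfrak{C}_{n,d}\le\sum_{l=0}^{n-1}M^{n-l}\big(\mathfrak{R}_d+\mathfrak{C}_{l,d}+\mathbf{1}_{\mathbb{N}}(l)\mathfrak{C}_{\max\{l-1,0\},d}\big).$$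 Then: (i) For every $d\in\mathfrak{D}$ there exists a unique function $v_d\colon\mathbb{X}_d\to\mathbb{R}^A$ which is $\mathcal{X}_d/(\bigotimes_{a\in A}\mathcal{B}(\mathbb{R}))$-measurable and satisfies for all $(x,a)\in\mathbb{X}_d\times A$ that $\sup_{y\in\mathbb{X}_d}\frac{\|v_d(y)\|_\infty}{\mathfrak{w}_d(y)}<\infty$, $\mathbb{E}[|f_d(X_d^{0,x,a},v_d(X_d^{0,x,a}))|]<\infty$, and $$\big(v_d(x)\big)(a)=\mathbb{E}\big[f_d(X_d^{0,x,a},v_d(X_d^{0,x,a}))\big].$$ (ii) There exist $N\colon(0,1]\to\mathbb{N}$ and $c\in\mathbb{R}$ such that for all $d\in\mathfrak{D}$, $\varepsilon\in(0,1]$ it holds that $\mathfrak{C}_{N_\varepsilon,d}\le c\,\mathfrak{R}_d\,\varepsilon^{-c}$ and $$\sup_{x\in\mathbb{X}_d}\bigg(\frac{\mathbb{E}\big[\|v_d(x)-V_{N_\varepsilon,d}^0(x)\|_\infty^2\big]}{|\mathfrak{w}_d(x)|^2}\bigg)^{1/2}\le\varepsilon.$$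
   Context: $\mathbb{N}=\{1,2,3,\dots\}$, $\mathbb{N}_0=\mathbb{N}\cup\{0\}$; $\mathbf{1}_{\mathbb{N}}$ is the indicator function of $\mathbb{N}$. $\mathbb{R}^A$ (resp. $\mathbb{X}_d^A$) is the set of functions $A\to\mathbb{R}$ (resp. $A\to\mathbb{X}_d$); $0\in\mathbb{R}^A$ also denotes the zero function; $\|r\|_\infty=\sup_{a\in A}|r(a)|$ for $r\in\mathbb{R}^A$. $X_d^{\theta,x,a}(\omega)=(X_d^\theta(x,\omega))(a)\in\mathbb{X}_d$. Indices in $\Theta$ are concatenated: for $\theta\in\mathbb{Z}^k$, $l,i\in\mathbb{Z}$, $(\theta,l,i)\in\mathbb{Z}^{k+2}\subseteq\Theta$; the index $0$ is $0\in\mathbb{Z}^1\subseteq\Theta$. The argument $\omega$ is suppressed: $V_{l,d}^\eta(X_d^{\vartheta,x,a})$ denotes $\omega\mapsto V_{l,d}^\eta(X_d^{\vartheta,x,a}(\omega),\omega)$. $N_\varepsilon$ denotes $N(\varepsilon)$. Empty sums are $0$. *)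

(* Defs.v *)
From HB Require Import structures.
From mathcomp Require Export all_boot all_order all_algebra.
From mathcomp Require Export all_classical all_reals all_analysis.

Set Implicit Arguments.
Unset Strict Implicit.
Unset Printing Implicit Defensive.

Import Order.TTheory GRing.Theory Num.Theory.
Import numFieldNormedType.Exports.

Local Open Scope classical_set_scope.
Local Open Scope ring_scope.

(** The index set Theta is the disjoint union of the Z^n, n >= 1: nonempty
    finite sequences of integers. *)
Definition Theta : choiceType := {s : seq int | s != [::]}.

Definition theta0 : Theta := Sub [:: 0 : int] isT.

Lemma theta_ext_subproof (s : seq int) (l i : int) : s ++ [:: l; i] != [::].
Proof. by case: s. Qed.

(** [theta_ext th l i] is the concatenation (th, l, i). *)
Definition theta_ext (th : Theta) (l i : int) : Theta :=
  Sub (val th ++ [:: l; i]) (theta_ext_subproof (val th) l i).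

(** The product measurable space T^I: functions I -> T with the smallest
    sigma-algebra that makes every evaluation map measurable. The index type I
    is arbitrary; it is used both for a finite I and for random fields. *)
Definition cylinders (I : Type) d (T : measurableType d) :
    set_system (I -> T) :=
  \bigcup_(i in [set: I])
    preimage_set_system [set: I -> T] (fun g => g i) measurable.

Definition prod_space (I : Type) d (T : measurableType d) :
    measurableType (sigma_display (@cylinders I d T)) :=
  g_sigma_algebraType (@cylinders I d T).

(** [prod_space A R] for real-valued functions, R with its Borel sets. *)
Notation Rpow A R := (@prod_space A _ (measurableTypeR R)).

Definition sub_sigma_algebra_of d (T : measurableType d)
    (G : set_system T) : Prop :=
  sigma_algebra [set: T] G /\ G `<=` measurable.

Definition independent_systems d (T : measurableType d) (R : realType)
    (P : probability T R) (I : choiceType) (G : I -> set_system T) : Prop :=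
  forall (s : seq I) (E : I -> set T), uniq s ->
    (forall i, i \in s -> G i (E i)) ->
    P (\bigcap_(i in [set` s]) E i) = (\prod_(i <- s) P (E i))%E.

Definition iid d (T : measurableType d) (R : realType) (P : probability T R)
    (I : choiceType) d' (S : measurableType d') (Y : I -> T -> S) : Prop :=
  [/\ forall i, measurable_fun [set: T] (Y i),
      independent_systems P (fun i => g_sigma_algebra_preimage (Y i)) &
      forall i j (B : set S), measurable B ->
        pushforward P (Y i) B = pushforward P (Y j) B].

(** I.i.d. random fields with parameter set K and values in S, i.e., i.i.d.
    random elements of the product measurable space S^K. *)
Definition iid_fields d (T : measurableType d) (R : realType)
    (P : probability T R) (I : choiceType) (K : Type)
    d' (S : measurableType d') (Y : I -> K -> T -> S) : Prop :=
  iid P (fun (i : I) (om : T) => (fun k => Y i k om) : prod_space K S).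

(** The supremum norm on R^A; a maximum since A is finite, and the default value
    0 is neutral since all terms are nonnegative. *)
Definition supnorm (R : realType) (A : finType) (r : A -> R) : R :=
  \big[Num.max/0]_(a : A) `|r a|.

(** [v] is a measurable, [w]-weighted bounded solution of the stochastic fixed
    point equation v(x)(a) = E[f(Y(x)(a), v(Y(x)(a)))]. *)
Definition sfpe_solution dO (Omega : measurableType dO) (R : realType)
    (P : probability Omega R) (A : finType) dX (X : measurableType dX)
    (w : X -> R) (f : X -> (A -> R) -> R) (Y : X -> Omega -> (A -> X))
    (v : X -> (A -> R)) : Prop :=
  [/\ measurable_fun [set: X] (v : X -> Rpow A R),
      (ereal_sup [set (supnorm (v y) / w y)%:E | y in [set: X]] < +oo)%E,
      forall (x : X) (a : A),
        ('E_P[fun om => `|f (Y x om a) (v (Y x om a))|%R] < +oo)%E &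
      forall (x : X) (a : A),
        (v x a)%:E = ('E_P[fun om => f (Y x om a) (v (Y x om a))])%E].

(* Main.v *)
From HB Require Import structures.
Require Import Defs.
From mathcomp Require Import measurable_realfun.
From mathcomp Require Import ring lra zify.

Set Implicit Arguments.
Unset Strict Implicit.
Unset Printing Implicit Defensive.

Import Order.TTheory GRing.Theory Num.Theory.
Import numFieldNormedType.Exports.

Local Open Scope classical_set_scope.
Local Open Scope ring_scope.

(** Fix d. On measurable functions v with |v| <= b w the map taking v to
    E[f(X(x,a), v(X(x,a)))] contracts the w-weighted supremum norm by the factor
    lambda L < 1, because f is L-Lipschitz and E[w(X(x,a))] <= lambda w(x).
    Picard iteration gives existence, contraction gives uniqueness, and the
    fixed point satisfies |v| <= kappa / (1 - q) w, where q denotes the supremum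
    over d of lambda_d L_d.

    Let e_n bound sup_x of the L2 norm of |V_n(x) - v(x)|_infty, divided by
    w(x). The error of V_n splits into a bias and a statistical error. The
    expectation of V_n telescopes over the levels to
    E[f(X, V_{n-1}(X))], so the bias is at most q e_{n-1}. The samples of one
    level are independent, so averaging M^(n-l) of them divides their L2 norm by
    M^((n-l)/2); a sample at level l > 0 has L2 norm at most
    q (e_l + e_{l-1}) w, and one at level 0 at most kappa w. The triangle
    inequality over levels and over a in A gives [error_step]:
      e_n <= q e_{n-1} + |A| (kappa m^n + sum_{0<l<n} m^(n-l) q (e_l + e_{l-1})),
    with m = M^(-1/2). A geometric sequence K rho^n with rho > m and
    large K solves this recursion as soon as
    q/rho + |A| q (1 + 1/rho) m/(rho - m) < 1. At rho = 1 this reads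
    1 + q (2|A| - 1) < (1 - q)/m, which is the assumption on M; by continuity it
    still holds for some rho < 1 ([contraction_rate]). None of the constants depends
    on d. The cost grows at most like (4M)^n, so taking n of order
    log(1/eps) makes the error at most eps at polynomial cost
    ([polynomial_complexity]).

    The probabilistic part rests on two facts. First, a function of two
    independent sigma-algebras that is evaluated on the diagonal can be
    integrated with two independent copies of the randomness ([decouple]);
    this computes expectations of a field at an independent random point and makes
    centred independent samples orthogonal in L2. Second, the telescoping compares
    V_{l-1} under different indices, so the law of the whole random field V_n^theta must not depend on
    theta ([V_same_law]). As V_n^theta is evaluated at random points, this has
    to be an equality of laws on the product space of all functions of x,
    proved by replacing one independent ingredient after the other
    ([decoupled_eqlaw]). *)

(** * Independent sigma-algebras and decoupling *)

Section decoupling.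
Context d (T : measurableType d) (R : realType) (P : probability T R).
Local Open Scope ereal_scope.

Definition indep_pair (G H : set_system T) :=
  forall A B, G A -> H B -> P (A `&` B) = P A * P B.

Lemma indep_pair_sym G H : indep_pair G H -> indep_pair H G.
Proof. by move=> GH A B HA GB; rewrite setIC GH// muleC. Qed.

(** For fixed B both sides are finite measures in A, the restriction of P to B
    and a multiple of P; they agree on a generating pi-system. *)
Lemma indep_pair_gen (G H : set_system T) :
  G `<=` measurable -> H `<=` measurable -> setI_closed G -> G setT ->
  indep_pair G H -> indep_pair <<s G >> H.
Proof.
move=> Gm Hm IG GT GH A B sA HB.
have mB := Hm _ HB.
have PB : P B = (fine (P B))%:E by rewrite fineK// fin_num_measure.
have PB0 : (0 <= fine (P B))%R by exact: fine_ge0.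
rewrite muleC PB -[(fine (P B))]/((NngNum PB0)%:num%R).
rewrite -[LHS]/(mrestr P mB A) -[RHS]/(mscale (NngNum PB0) P A).
apply: (g_sigma_algebra_measure_unique G Gm (fun=> setT)) => //.
- by apply/seteqP; split => // x _; exists 0%N.
- by move=> C GC; rewrite /= /mrestr /mscale/= GH// -PB muleC.
- move=> k; rewrite /= /mrestr setTI.
  by rewrite (le_lt_trans (probability_le1 _ mB))// ltry.
Qed.

Lemma indep_pair_sigma (G H : set_system T) :
  G `<=` measurable -> H `<=` measurable -> setI_closed G -> setI_closed H ->
  G setT -> H setT -> indep_pair G H -> indep_pair <<s G >> <<s H >>.
Proof.
move=> Gm Hm IG IH GT HT GH.
apply: indep_pair_sym; apply: indep_pair_gen => //.
  by apply: smallest_sub => //; exact: sigma_algebra_measurable.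
by apply: indep_pair_sym; exact: indep_pair_gen.
Qed.

Lemma measurable_id_gen (G : set_system T) : G `<=` measurable ->
  measurable_fun [set: T] (id : T -> g_sigma_algebraType G).
Proof.
move=> Gm _ A mA; rewrite setTI preimage_id.
by move: A mA; apply: smallest_sub => //; exact: sigma_algebra_measurable.
Qed.

(** The diagonal map pushes P forward to a measure on the product of the two
    sigma-algebras that equals P x P on rectangles, hence everywhere; then
    Tonelli applies. *)
Lemma decouple (G H : set_system T)
    (Psi : g_sigma_algebraType G * g_sigma_algebraType H -> \bar R) :
  G `<=` measurable -> H `<=` measurable -> indep_pair <<s G >> <<s H >> ->
  measurable_fun [set: g_sigma_algebraType G * g_sigma_algebraType H] Psi ->
  (forall z, 0 <= Psi z) ->
  \int[P]_om Psi (om, om) = \int[P]_om1 \int[P]_om2 Psi (om1, om2).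
Proof.
move=> Gm Hm GH mPsi Psi0.
have mG := measurable_id_gen Gm; have mH := measurable_id_gen Hm.
pose XG : {mfun T >-> g_sigma_algebraType G} :=
  HB.pack (id : T -> g_sigma_algebraType G) (isMeasurableFun.Build _ _ _ _ _ mG).
pose XH : {mfun T >-> g_sigma_algebraType H} :=
  HB.pack (id : T -> g_sigma_algebraType H) (isMeasurableFun.Build _ _ _ _ _ mH).
pose PG := distribution P XG; pose PH := distribution P XH.
pose diag := fun om : T => (om : g_sigma_algebraType G, om : g_sigma_algebraType H).
have mdiag : measurable_fun setT diag by exact: measurable_fun_pair.
pose XD : {mfun T >-> (g_sigma_algebraType G * g_sigma_algebraType H)%type} :=
  HB.pack diag (isMeasurableFun.Build _ _ _ _ _ mdiag).
transitivity (\int[distribution P XD]_z Psi z).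
  by rewrite ge0_integral_pushforward// => z _.
transitivity (\int[PG \x PH]_z Psi z).
  apply: eq_measure_integral => A mA _; apply/esym.
  apply: (product_measure_unique (m1 := PG) (m2 := PH)) => //.
rewrite fubini_tonelli1//.
transitivity (\int[PG]_x \int[P]_y Psi (x, y)).
  apply: eq_integral => x _.
  rewrite /fubini_F ge0_integral_pushforward//.
  exact: (measurable_fun_pair2 x mPsi).
have := measurable_fun_fubini_tonelli_F (m2 := PH) _ mPsi.
move=> /(_ Psi0) mF.
rewrite ge0_integral_pushforward//.
- apply: (@eq_measurable_fun _ _ _ _ _ (fubini_F PH Psi)) => // x _.
  rewrite /fubini_F ge0_integral_pushforward//.
  exact: (measurable_fun_pair2 x mPsi).
- by move=> x _; exact: integral_ge0.
Qed.

End decoupling.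

(** * Measurability in product spaces *)

Section product_space.
Context (I : Type) d (T : measurableType d).

Lemma measurable_to_prod d' (U : measurableType d') (g : U -> I -> T) :
  (forall i, measurable_fun [set: U] (fun u => g u i)) ->
  measurable_fun [set: U] (g : U -> prod_space I T).
Proof.
move=> mg.
apply: (@measurability _ _ U (prod_space I T) setT g (@cylinders I d T)) => //.
move=> _ [_ [i _ [B mB <-]] <-].
rewrite !setTI; have := mg i measurableT _ mB; rewrite setTI.
exact.
Qed.

Lemma measurable_eval (i : I) :
  measurable_fun [set: prod_space I T] (fun g : prod_space I T => g i).
Proof.
move=> _ B mB; apply: sub_sigma_algebra; exists i => //; exists B => //.
Qed.

Lemma measurable_coord d' (U : measurableType d') (g : U -> prod_space I T) i :
  measurable_fun [set: U] g -> measurable_fun [set: U] (fun u => g u i).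
Proof. by move=> mg; exact: (measurableT_comp (measurable_eval i) mg). Qed.

End product_space.

(** * Blocks of an independent family *)

Section blocks.
Context d (T : measurableType d) (R : realType) (P : probability T R).
Context (I : choiceType) (F : I -> set_system T).
Hypothesis Fsub : forall i, sub_sigma_algebra_of (F i).
Hypothesis Find : independent_systems P F.

Definition block (S : set I) : set_system T := \bigcup_(i in S) F i.

Lemma block_measurable S : block S `<=` measurable.
Proof. by move=> A [i _ FA]; have [_] := Fsub i; exact. Qed.

Lemma block_mono S S' : S `<=` S' -> block S `<=` block S'.
Proof. by move=> SS' A [i Si FA]; exists i => //; exact: SS'. Qed.

(** Finite intersections of events from the sigma-algebras with index in S: a
    pi-system generating the same sigma-algebra as their union. *)
Definition boxes (S : set I) : set_system T :=
  [set A | exists (s : seq I) (E : I -> set T),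
     [/\ uniq s, {in s, forall i, S i}, {in s, forall i, F i (E i)} &
         A = \bigcap_(i in [set` s]) E i]].

Lemma sub_sigmaT i : F i setT.
Proof. by have [[F0 FC _] _] := Fsub i; rewrite -(setD0 setT); exact: FC. Qed.

Lemma sub_sigmaI i A B : F i A -> F i B -> F i (A `&` B).
Proof.
move=> FA FB; have [sF _] := Fsub i.
have FE := measurable_g_measurableTypeE sF.
by rewrite -FE in FA FB *; exact: measurableI.
Qed.

Lemma boxes_setI S : setI_closed (boxes S).
Proof.
move=> _ _ [s [E [us sS sF ->]]] [s' [E' [us' sS' sF' ->]]].
(* An index that occurs on both sides carries the intersection of its two events;
   an index missing on one side carries the full event there. *)
exists (undup (s ++ s')), (fun i => (if i \in s then E i else setT) `&`
  (if i \in s' then E' i else setT)); split.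
- exact: undup_uniq.
- by move=> i; rewrite mem_undup mem_cat => /orP[/sS|/sS'].
- move=> i _; apply: sub_sigmaI.
    by case: ifPn => [/sF//|_]; exact: sub_sigmaT.
  by case: ifPn => [/sF'//|_]; exact: sub_sigmaT.
- apply/seteqP; split=> x /=.
    move=> [xE xE'] i _; split; case: ifPn => // ii; [exact: xE|exact: xE'].
  move=> H; split => i /= ii.
    have := H i; rewrite /= mem_undup mem_cat ii => /(_ isT)[//].
  by have := H i; rewrite /= mem_undup mem_cat ii orbT => /(_ isT)[].
Qed.

Lemma boxes_measurable S : boxes S `<=` measurable.
Proof.
move=> _ [s [E [us _ sF ->]]]; apply: fin_bigcap_measurable; first exact: finite_seq.
by move=> i /sF; have [_] := Fsub i; exact.
Qed.

Lemma boxesT S : boxes S setT.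
Proof.
exists [::], (fun=> setT); split => //.
by apply/seteqP; split.
Qed.


Lemma block_boxes S : block S `<=` boxes S.
Proof.
move=> A [i Si FA]; exists [:: i], (fun=> A); split => //.
- by move=> j; rewrite inE => /eqP ->.
- by move=> j; rewrite inE => /eqP ->.
apply/seteqP; split => x /=.
  by move=> Ax j _.
by apply; rewrite /= inE.
Qed.

Lemma boxes_indep S S' : S `&` S' = set0 -> indep_pair P (boxes S) (boxes S').
Proof.
move=> SS' _ _ [s [E [us sS sF ->]]] [s' [E' [us' sS' sF' ->]]].
pose E'' i := if i \in s then E i else E' i.
have dis i : i \in s -> i \in s' -> False.
  move=> /sS Si /sS' S'i; suff : (S `&` S') i by rewrite SS'.
  by split.
have nin i : i \in s' -> (i \in s) = false.
  by move=> is'; apply/negP => /dis; apply.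
have -> : \bigcap_(i in [set` s]) E i `&` \bigcap_(i in [set` s']) E' i =
    \bigcap_(i in [set` s ++ s']) E'' i.
  apply/seteqP; split => x /=.
    move=> [xE xE'] i /=; rewrite mem_cat /E''; case: ifPn => [/xE//|_ /= /xE'].
    exact.
  move=> H; split => i /= ii.
    by have := H i; rewrite /= mem_cat /E'' ii; exact.
  by have := H i; rewrite /= mem_cat /E'' (nin _ ii) ii; exact.
rewrite Find; last 2 first.
- rewrite cat_uniq us us' andbT; apply/hasPn => i /= is'.
  by rewrite (nin _ is').
- move=> i; rewrite mem_cat /E''; case: ifPn => [/sF//|_ /= /sF'].
  exact.
rewrite big_cat/= Find// Find//.
congr (_ * _)%E; apply: eq_big_seq => i ii; rewrite /E'' ?ii//.
by rewrite nin.
Qed.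

(** Blocks over disjoint index sets are independent: on the generating boxes the
    two finite products concatenate to one product over distinct indices. *)
Lemma block_indep S S' : S `&` S' = set0 ->
  indep_pair P <<s block S >> <<s block S' >>.
Proof.
move=> SS' A B sA sB.
apply: (indep_pair_sigma (@boxes_measurable S) (@boxes_measurable S')
  (@boxes_setI S) (@boxes_setI S') (boxesT S) (boxesT S') (boxes_indep SS')).
- by apply: sub_sigma_algebra2 sA; exact: block_boxes.
- by apply: sub_sigma_algebra2 sB; exact: block_boxes.
Qed.

End blocks.

(** * Equality in law *)

Section equal_laws.
Context d (T : measurableType d) (R : realType) (P : probability T R).

(** Equality of laws stated through test functions, the form in which it is used
    under iterated integrals. *)
Definition eqlaw d' (U : measurableType d') (X X' : T -> U) :=
  forall phi : U -> \bar R, measurable_fun [set: U] phi ->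
    (forall u, 0 <= phi u)%E ->
    (\int[P]_om phi (X om) = \int[P]_om phi (X' om))%E.

Lemma pushforward_eqlaw d' (U : measurableType d') (X X' : T -> U) :
  measurable_fun [set: T] X -> measurable_fun [set: T] X' ->
  (forall B, measurable B -> pushforward P X B = pushforward P X' B) ->
  eqlaw X X'.
Proof.
move=> mX mX' XX' phi mphi phi0.
transitivity (\int[pushforward P X]_u phi u)%E.
  by rewrite ge0_integral_pushforward.
transitivity (\int[pushforward P X']_u phi u)%E.
  by apply: eq_measure_integral => A mA _; exact: XX'.
by rewrite ge0_integral_pushforward.
Qed.

Lemma eqlaw_comp d' (U : measurableType d') d'' (W : measurableType d'')
    (X X' : T -> U) (h : U -> W) :
  measurable_fun [set: U] h -> eqlaw X X' ->
  eqlaw (fun om => h (X om)) (fun om => h (X' om)).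
Proof.
move=> mh XX' phi mphi phi0.
apply: (XX' (phi \o h)); first exact: (measurableT_comp mphi mh).
by move=> u; exact: phi0.
Qed.

Lemma eqlaw_integral d' (U : measurableType d') (X X' : T -> U) (h : U -> \bar R) :
  measurable_fun [set: U] h -> eqlaw X X' ->
  (\int[P]_om h (X om) = \int[P]_om h (X' om))%E.
Proof.
move=> mh XX'.
have E (Y : T -> U) : (\int[P]_om h (Y om) =
    \int[P]_om (h^\+ (Y om)) - \int[P]_om (h^\- (Y om)))%E.
  rewrite integralE; congr (_ - _)%E; apply: eq_integral => om _.
    by rewrite !funeposE.
  by rewrite !funenegE.
rewrite !E; congr (_ - _)%E.
  by apply: (XX' _ (measurable_funepos mh)) => u; exact: funepos_ge0.
by apply: (XX' _ (measurable_funeneg mh)) => u; exact: funeneg_ge0.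
Qed.

Section decoupled.
Variables (G H G' H' : set_system T).
Hypotheses (Gm : G `<=` measurable) (Hm : H `<=` measurable).
Hypotheses (Gm' : G' `<=` measurable) (Hm' : H' `<=` measurable).
Hypotheses (GH : indep_pair P <<s G >> <<s H >>).
Hypotheses (GH' : indep_pair P <<s G' >> <<s H' >>).

Lemma measurable_gen_prod G1 G2 d' (W : measurableType d')
    (h : g_sigma_algebraType G1 * g_sigma_algebraType G2 -> W) :
  G1 `<=` measurable -> G2 `<=` measurable ->
  measurable_fun [set: g_sigma_algebraType G1 * g_sigma_algebraType G2] h ->
  measurable_fun [set: T * T] h.
Proof.
move=> mG1 mG2 mh.
have := @measurable_fun_pair _ _ _ (T * T)%type (g_sigma_algebraType G1)
  (g_sigma_algebraType G2) fst snd
  (measurableT_comp (measurable_id_gen mG1) measurable_fst)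
  (measurableT_comp (measurable_id_gen mG2) measurable_snd).
move=> /(measurableT_comp mh); apply: eq_measurable_fun => -[x y] _ //.
Qed.

Local Open Scope ereal_scope.

(** After decoupling, Z is replaced by Z' in the inner integral, then the order
    of integration is exchanged and X is replaced by X'. Measurability of
    Phi is asked along the paths of the variables only, because evaluating a
    random field at a point is not jointly measurable on the product space. *)
Lemma decoupled_eqlaw d1 (U1 : measurableType d1) d2 (U2 : measurableType d2)
    (X X' : T -> U1) (Z Z' : T -> U2) (Phi : U1 -> U2 -> \bar R) :
  (forall u v, 0 <= Phi u v) -> eqlaw X X' -> eqlaw Z Z' ->
  measurable_fun [set: g_sigma_algebraType G * g_sigma_algebraType H]
    (fun p : g_sigma_algebraType G * g_sigma_algebraType H =>
       Phi (X p.1) (Z p.2)) ->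
  measurable_fun [set: g_sigma_algebraType G' * g_sigma_algebraType H']
    (fun p : g_sigma_algebraType G' * g_sigma_algebraType H' =>
       Phi (X' p.1) (Z' p.2)) ->
  measurable_fun [set: T * T] (fun p : T * T => Phi (X p.1) (Z' p.2)) ->
  (forall om, measurable_fun [set: U2] (Phi (X om))) ->
  (forall om, measurable_fun [set: U1] (Phi ^~ (Z' om))) ->
  \int[P]_om Phi (X om) (Z om) = \int[P]_om Phi (X' om) (Z' om).
Proof.
move=> Phi0 XX' ZZ' mXZ mXZ' mXZ'' mX mZ'.
transitivity (\int[P]_om1 \int[P]_om2 Phi (X om1) (Z om2)).
  by apply: (decouple Gm Hm GH mXZ) => z; exact: Phi0.
transitivity (\int[P]_om1 \int[P]_om2 Phi (X om1) (Z' om2)).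
  by apply: eq_integral => om _; exact: ZZ'.
transitivity (\int[P]_om2 \int[P]_om1 Phi (X om1) (Z' om2)).
  by apply: (fubini_tonelli _ mXZ'') => z; exact: Phi0.
transitivity (\int[P]_om2 \int[P]_om1 Phi (X' om1) (Z' om2)).
  by apply: eq_integral => om _; exact: (XX' (Phi ^~ (Z' om))).
transitivity (\int[P]_om1 \int[P]_om2 Phi (X' om1) (Z' om2)).
  apply/esym; apply: (fubini_tonelli _ (measurable_gen_prod Gm' Hm' mXZ')) => z.
  exact: Phi0.
by apply/esym; apply: (decouple Gm' Hm' GH' mXZ') => z; exact: Phi0.
Qed.

(** Sums of independent fields: the law of a sum is determined by the laws of its
    independent summands. *)
Lemma eqlaw_add (K : Type) (X X' Z Z' : T -> prod_space K (measurableTypeR R)) :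
  eqlaw X X' -> eqlaw Z Z' ->
  (forall k, measurable_fun [set: g_sigma_algebraType G] (X ^~ k)) ->
  (forall k, measurable_fun [set: g_sigma_algebraType H] (Z ^~ k)) ->
  (forall k, measurable_fun [set: g_sigma_algebraType G'] (X' ^~ k)) ->
  (forall k, measurable_fun [set: g_sigma_algebraType H'] (Z' ^~ k)) ->
  eqlaw ((fun om k => X om k + Z om k)%R : T -> prod_space K (measurableTypeR R))
    (fun om k => X' om k + Z' om k)%R.
Proof.
move=> XX' ZZ' mX mZ mX' mZ' phi mphi phi0.
pose Phi (u v : prod_space K (measurableTypeR R)) :=
  phi (fun k => (u k + v k)%R : measurableTypeR R).
have mT G0 (Y : T -> prod_space K (measurableTypeR R)) : G0 `<=` measurable ->
    (forall k, measurable_fun [set: g_sigma_algebraType G0] (Y ^~ k)) ->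
    forall k, measurable_fun [set: T] (Y ^~ k).
  by move=> mG0 mY k; exact: (measurableT_comp (mY k) (measurable_id_gen mG0)).
have mPhi d' (W : measurableType d') (g : W -> K -> measurableTypeR R) :
    (forall k, measurable_fun [set: W] (g ^~ k)) ->
    measurable_fun [set: W] (fun w => phi (g w)).
  by move=> mg; exact: (measurableT_comp mphi (measurable_to_prod mg)).
apply: (decoupled_eqlaw (Phi := Phi)) => //; first by move=> u v; exact: phi0.
- apply: (mPhi _ (g_sigma_algebraType G * g_sigma_algebraType H)%type
    (fun p k => X p.1 k + Z p.2 k)%R) => k.
  apply: measurable_funD; first exact: (measurableT_comp (mX k) measurable_fst).
  exact: (measurableT_comp (mZ k) measurable_snd).
- apply: (mPhi _ (g_sigma_algebraType G' * g_sigma_algebraType H')%type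
    (fun p k => X' p.1 k + Z' p.2 k)%R) => k.
  apply: measurable_funD; first exact: (measurableT_comp (mX' k) measurable_fst).
  exact: (measurableT_comp (mZ' k) measurable_snd).
- apply: (mPhi _ (T * T)%type (fun p k => X p.1 k + Z' p.2 k)%R) => k.
  apply: measurable_funD.
    exact: (measurableT_comp (mT _ _ Gm mX k) measurable_fst).
  exact: (measurableT_comp (mT _ _ Hm' mZ' k) measurable_snd).
- move=> om; apply: (mPhi _ (prod_space K (measurableTypeR R)) (fun v k => X om k + v k)%R) => k.
  apply: measurable_funD => //; exact: measurable_eval.
- move=> om; apply: (mPhi _ (prod_space K (measurableTypeR R)) (fun u k => u k + Z' om k)%R) => k.
  apply: measurable_funD => //; exact: measurable_eval.
Qed.

End decoupled.

End equal_laws.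

(** * Random fields at independent random points *)

Section field_composition.
Context d (T : measurableType d) (R : realType) (P : probability T R).
Context dX (X : measurableType dX) (A : Type).
Variables (G H G' H' : set_system T).
Hypotheses (Gm : G `<=` measurable) (Hm : H `<=` measurable).
Hypotheses (Gm' : G' `<=` measurable) (Hm' : H' `<=` measurable).
Hypotheses (GH : indep_pair P <<s G >> <<s H >>).
Hypotheses (GH' : indep_pair P <<s G' >> <<s H' >>).

(** The law of h(Y(x,a)), as a field in (x,a), depends only on the laws of the
    independent fields h and Y. Although the evaluation map (y, u) |-> u o y is
    not measurable on the product of the two path spaces, it is measurable in u
    for fixed y, and in y for u a path of h'. *)
Lemma eqlaw_field_comp (Y Y' : X -> T -> A -> X) (h h' : X -> T -> R) :
  eqlaw P (fun om => (fun x => Y x om) : prod_space X (prod_space A X))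
    (fun om x => Y' x om) ->
  eqlaw P (fun om => (fun x => h x om) : prod_space X (measurableTypeR R))
    (fun om x => h' x om) ->
  (forall x a, measurable_fun [set: g_sigma_algebraType G] (fun om => Y x om a)) ->
  (forall x a, measurable_fun [set: g_sigma_algebraType G'] (fun om => Y' x om a)) ->
  measurable_fun [set: X * g_sigma_algebraType H]
    (fun p : X * g_sigma_algebraType H => h p.1 p.2) ->
  measurable_fun [set: X * g_sigma_algebraType H']
    (fun p : X * g_sigma_algebraType H' => h' p.1 p.2) ->
  eqlaw P (fun om => (fun k => h (Y k.1 om k.2) om) : prod_space (X * A) (measurableTypeR R))
    (fun om k => h' (Y' k.1 om k.2) om).
Proof.
move=> YY' hh' mY mY' mh mh' phi mphi phi0.
pose Phi (y : prod_space X (prod_space A X)) (u : prod_space X (measurableTypeR R)) :=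
  phi (fun k : X * A => u (y k.1 k.2)).
have mPhi d' (W : measurableType d') (g : W -> X * A -> measurableTypeR R) :
    (forall k, measurable_fun [set: W] (g ^~ k)) ->
    measurable_fun [set: W] (fun w => phi (g w)).
  by move=> mg; exact: (measurableT_comp mphi (measurable_to_prod mg)).
have mhY G0 H0 (Y0 : X -> T -> A -> X) (h0 : X -> T -> R) k :
  (forall x a, measurable_fun [set: g_sigma_algebraType G0] (fun om => Y0 x om a)) ->
  measurable_fun [set: X * g_sigma_algebraType H0]
    (fun p : X * g_sigma_algebraType H0 => h0 p.1 p.2) ->
  measurable_fun [set: g_sigma_algebraType G0 * g_sigma_algebraType H0]
   (fun p : g_sigma_algebraType G0 * g_sigma_algebraType H0 =>
     h0 (Y0 k.1 p.1 k.2) p.2).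
  move=> mY0 mh0.
  apply: (measurableT_comp mh0 (g := fun p : g_sigma_algebraType G0 *
    g_sigma_algebraType H0 => (Y0 k.1 p.1 k.2, p.2))).
  apply: measurable_fun_pair; last exact: measurable_snd.
  exact: (measurableT_comp (mY0 _ _) measurable_fst).
pose YT om : prod_space X (prod_space A X) := fun x => Y x om.
pose YT' om : prod_space X (prod_space A X) := fun x => Y' x om.
pose hT om : prod_space X (measurableTypeR R) := fun x => h x om.
pose hT' om : prod_space X (measurableTypeR R) := fun x => h' x om.
apply: (decoupled_eqlaw Gm Hm Gm' Hm' GH GH' (Phi := Phi) (X := YT)
  (X' := YT') (Z := hT) (Z' := hT')) => //.
- by move=> u v; exact: phi0.
- apply: (mPhi _ (g_sigma_algebraType G * g_sigma_algebraType H)%type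
    (fun p k => h (Y k.1 p.1 k.2) p.2)) => k; exact: (mhY _ _ _ _ _ mY mh).
- apply: (mPhi _ (g_sigma_algebraType G' * g_sigma_algebraType H')%type
    (fun p k => h' (Y' k.1 p.1 k.2) p.2)) => k; exact: (mhY _ _ _ _ _ mY' mh').
- apply: (mPhi _ (T * T)%type (fun p k => h' (Y k.1 p.1 k.2) p.2)) => k.
  exact: (measurable_gen_prod Gm Hm' (mhY _ _ _ _ _ mY mh')).
- move=> om; apply: (mPhi _ (prod_space X (measurableTypeR R))
    (fun u k => u (Y k.1 om k.2))) => k; exact: measurable_eval.
- move=> om; apply: (mPhi _ (prod_space X (prod_space A X))
    (fun y k => h' (y k.1 k.2) om)) => k.
  apply: (measurableT_comp (f := fun x => h' x om)).
    exact: (measurable_fun_pair1 (f := fun p : X * g_sigma_algebraType H' => h' p.1 p.2)).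
  exact: (measurable_coord _ (measurable_eval _)).
Qed.

End field_composition.

(** * Bounds in L2 *)

Section L2.
Context d (T : measurableType d) (R : realType) (P : probability T R).
Local Open Scope ereal_scope.

(** For b >= 0 this says that the L2 norm of Z is at most b; the squared form
    avoids roots of extended reals. *)
Definition L2le (Z : T -> R) (b : R) :=
  \int[P]_om ((Z om ^+ 2)%:E) <= (b ^+ 2)%:E.

Lemma sqr_lim (x : \bar R) (r : R) : (0 <= r)%R ->
  (forall e : R, (0 < e)%R -> x <= ((r + e) ^+ 2)%:E) -> x <= (r ^+ 2)%:E.
Proof.
move=> r0 H; apply/lee_addgt0Pr => e e0.
pose t := (Num.min 1 (e / (2 * r + 1)))%R.
have r1 : (0 < 2 * r + 1)%R by lra.
have t0 : (0 < t)%R by rewrite /t lt_min ltr01 divr_gt0.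
apply: (le_trans (H _ t0)); rewrite -EFinD lee_fin.
have t1 : (t <= 1)%R by rewrite /t ge_min lexx.
have t2 : (t * (2 * r + 1) <= e)%R.
  by rewrite -ler_pdivlMr// /t ge_min lexx orbT.
nra.
Qed.

Lemma L2le_le (Z W : T -> R) b c : measurable_fun setT Z -> measurable_fun setT W ->
  (forall om, `|Z om| <= `|W om|)%R -> (0 <= b <= c)%R ->
  L2le W b -> L2le Z c.
Proof.
move=> mZ mW ZW bc WB; apply: (@le_trans _ _ (b ^+ 2)%:E); last first.
  by rewrite lee_fin; case/andP: bc => b0 bc; nra.
apply: le_trans WB; apply: ge0_le_integral => //.
- by move=> om _; rewrite lee_fin sqr_ge0.
- by apply/measurable_EFinP; exact: measurable_funX.
- by apply/measurable_EFinP; exact: measurable_funX.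
- by move=> om _; rewrite lee_fin -(real_normK (num_real (Z om))) -(real_normK (num_real (W om))) lerXn2r ?nnegrE.
Qed.

Lemma L2le_scale (Z : T -> R) k b : measurable_fun setT Z -> L2le Z b ->
  L2le (fun om => k * Z om)%R (k * b)%R.
Proof.
move=> mZ; rewrite /L2le => H.
under eq_integral do rewrite exprMn (EFinM (k ^+ 2)).
rewrite ge0_integralZl//.
- by rewrite exprMn (EFinM (k ^+ 2)) lee_wpmul2l// lee_fin sqr_ge0.
- by apply/measurable_EFinP; exact: measurable_funX.
- by move=> om _; rewrite lee_fin sqr_ge0.
- by rewrite lee_fin sqr_ge0.
Qed.

(** Minkowski's inequality. For positive b and c it follows by integrating
    (z + w)^2 <= (1 + c/b) z^2 + (1 + b/c) w^2, whose weights turn b^2 and c^2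
    into exactly (b + c)^2; the degenerate cases follow by enlarging b and c. *)
Lemma L2le_add (Z W : T -> R) b c : measurable_fun setT Z -> measurable_fun setT W ->
  (0 <= b)%R -> (0 <= c)%R -> L2le Z b -> L2le W c ->
  L2le (fun om => Z om + W om)%R (b + c)%R.
Proof.
move=> mZ mW.
suff pos b' c' : (0 < b')%R -> (0 < c')%R -> L2le Z b' -> L2le W c' ->
    L2le (fun om => Z om + W om)%R (b' + c')%R.
  move=> b0 c0 Zb Wc; apply: sqr_lim; first exact: addr_ge0.
  move=> e e0; have -> : (b + c + e = (b + e / 2) + (c + e / 2))%R by field.
  apply: pos; [lra|lra| |].
    by apply: (L2le_le mZ mZ _ _ Zb) => //; lra.
  by apply: (L2le_le mW mW _ _ Wc) => //; lra.
move=> b0 c0 Zb Wc.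
have mZ2 : measurable_fun setT (fun om => (Z om ^+ 2)%:E).
  by apply/measurable_EFinP; exact: measurable_funX.
have mW2 : measurable_fun setT (fun om => (W om ^+ 2)%:E).
  by apply/measurable_EFinP; exact: measurable_funX.
have cb0 : (0 <= c' / b')%R by rewrite divr_ge0// ltW.
have bc0 : (0 <= b' / c')%R by rewrite divr_ge0// ltW.
apply: (@le_trans _ _ (\int[P]_om ((1 + c' / b')%:E * (Z om ^+ 2)%:E +
    (1 + b' / c')%:E * (W om ^+ 2)%:E))).
  apply: ge0_le_integral => //.
  - by move=> om _; rewrite lee_fin sqr_ge0.
  - apply/measurable_EFinP; apply: measurable_funX; exact: measurable_funD.
  - apply: emeasurable_funD; exact: emeasurable_funM.
  - move=> om _; rewrite -!EFinM -EFinD lee_fin.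
    set z := Z om; set w := W om.
    rewrite -subr_ge0.
    have -> : ((1 + c' / b') * z ^+ 2 + (1 + b' / c') * w ^+ 2 - (z + w) ^+ 2 =
      (c' * z - b' * w) ^+ 2 / (b' * c'))%R by field; rewrite !gt_eqF.
    by rewrite divr_ge0 ?sqr_ge0// mulr_ge0// ltW.
rewrite ge0_integralD//; last 4 first.
- by move=> om _; rewrite -EFinM lee_fin mulr_ge0 ?sqr_ge0// addr_ge0.
- exact: emeasurable_funM.
- by move=> om _; rewrite -EFinM lee_fin mulr_ge0 ?sqr_ge0// addr_ge0.
- exact: emeasurable_funM.
rewrite !ge0_integralZl//; last 4 first.
- by move=> om _; rewrite lee_fin sqr_ge0.
- by rewrite lee_fin addr_ge0.
- by move=> om _; rewrite lee_fin sqr_ge0.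
- by rewrite lee_fin addr_ge0.
have -> : ((b' + c') ^+ 2 = (1 + c' / b') * b' ^+ 2 + (1 + b' / c') * c' ^+ 2)%R.
  by field; rewrite !gt_eqF.
by rewrite [in leRHS]EFinD (EFinM (1 + c' / b')%R) (EFinM (1 + b' / c')%R) leeD// lee_wpmul2l// lee_fin addr_ge0.
Qed.

Lemma L2le_sum (J : eqType) (s : seq J) (Z : J -> T -> R) (b : J -> R) :
  (forall j, j \in s -> measurable_fun setT (Z j)) ->
  (forall j, j \in s -> (0 <= b j)%R) ->
  (forall j, j \in s -> L2le (Z j) (b j)) ->
  L2le (fun om => \sum_(j <- s) Z j om)%R (\sum_(j <- s) b j)%R.
Proof.
elim: s => [|j s IH] mZ b0 Zb.
  rewrite /L2le (eq_integral (cst 0)) => [|om _]; last by rewrite big_nil expr0n.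
  by rewrite integral0 lee_fin sqr_ge0.
have js i : i \in s -> i \in j :: s by rewrite inE orbC => ->.
have jj : j \in j :: s by rewrite inE eqxx.
rewrite big_cons; under [X in L2le X _]eq_fun do rewrite big_cons.
apply: L2le_add.
- exact: mZ.
- have -> : (fun om => \sum_(j <- s) Z j om)%R =
    (fun om => \sum_(j <- s) (if j \in s then Z j om else 0))%R.
    by apply/funext => om; apply: eq_big_seq => i ->.
  apply: measurable_sum => i; case: (boolP (i \in s)) => [/js|_].
    exact: mZ.
  exact: measurable_cst.
- exact: b0.
- by rewrite big_seq sumr_ge0// => i /js; exact: b0.
- exact: Zb.
- by apply: IH => i /js; [exact: mZ|exact: b0|exact: Zb].
Qed.

End L2.

Section L2_moments.
Context d (T : measurableType d) (R : realType) (P : probability T R).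

Lemma L2le_sqr_integrable (Z : T -> R) b : measurable_fun setT Z -> L2le P Z b ->
  P.-integrable setT (fun om => (Z om ^+ 2)%:E).
Proof.
move=> mZ Zb; apply/integrableP; split.
  by apply/measurable_EFinP; exact: measurable_funX.
apply: (@le_lt_trans _ _ (b ^+ 2)%:E); last exact: ltry.
apply: le_trans Zb; apply: ge0_le_integral => //.
- apply: (measurableT_comp (f := abse)) => //.
  by apply/measurable_EFinP; exact: measurable_funX.
- by apply/measurable_EFinP; exact: measurable_funX.
- by move=> om _; rewrite abse_EFin ger0_norm ?sqr_ge0.
Qed.

Lemma L2le_integrable (Z : T -> R) b : measurable_fun setT Z -> L2le P Z b ->
  P.-integrable setT (fun om => (Z om)%:E).
Proof.
move=> mZ Zb.
have : P.-integrable setT (fun om => (1%:E + (Z om ^+ 2)%:E)%E).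
  apply: integrableD => //; last exact: (L2le_sqr_integrable mZ Zb).
  exact: finite_measure_integrable_cst.
apply: le_integrable => //; first exact/measurable_EFinP.
move=> om _; rewrite -EFinD !abse_EFin lee_fin (@ger0_norm _ (1 + _)).
  have := sqr_ge0 (`|Z om| - 1); rewrite -(real_normK (num_real (Z om))).
  have := normr_ge0 (Z om); nra.
by rewrite addr_ge0// sqr_ge0.
Qed.

(** Integrate |z| <= (z^2 / b + b) / 2, after enlarging b to make it positive. *)
Lemma L2le_L1 (Z : T -> R) b : measurable_fun setT Z -> 0 <= b -> L2le P Z b ->
  (\int[P]_om `|Z om|%:E <= b%:E)%E.
Proof.
move=> mZ; have pos c : 0 < c -> L2le P Z c -> (\int[P]_om `|Z om|%:E <= c%:E)%E.
  move=> c0 Zc.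
  have k0 : 0 <= (2 * c)^-1 by rewrite invr_ge0 mulr_ge0 ?ler0n// ltW.
  have c2 : 0 <= c / 2 by rewrite divr_ge0 ?ler0n// ltW.
  have mZ2 : measurable_fun setT (fun om => (Z om ^+ 2)%:E).
    by apply/measurable_EFinP; exact: measurable_funX.
  apply: (@le_trans _ _ (\int[P]_om ((2 * c)^-1%:E * (Z om ^+ 2)%:E + (c / 2)%:E))%E).
    apply: ge0_le_integral => //.
    - by apply/measurable_EFinP; apply: measurableT_comp.
    - by apply: emeasurable_funD => //; exact: emeasurable_funM.
    - move=> om _; rewrite -EFinM -EFinD lee_fin.
      rewrite -(real_normK (num_real (Z om))); set z := `|Z om|.
      rewrite -subr_ge0.
      have -> : (2 * c)^-1 * z ^+ 2 + c / 2 - z = (z - c) ^+ 2 / (2 * c).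
        by field; rewrite gt_eqF.
      by rewrite mulr_ge0 ?sqr_ge0.
  rewrite ge0_integralD//; last 2 first.
  - by move=> om _; rewrite -EFinM lee_fin mulr_ge0 ?sqr_ge0.
  - exact: emeasurable_funM.
  rewrite ge0_integralZl//; last by move=> om _; rewrite lee_fin sqr_ge0.
  rewrite integral_cst//= probability_setT mule1.
  apply: (@le_trans _ _ ((2 * c)^-1%:E * (c ^+ 2)%:E + (c / 2)%:E)%E).
    by rewrite leeD2r// lee_wpmul2l// lee_fin.
  rewrite -EFinM -EFinD lee_fin le_eqVlt; apply/orP; left; apply/eqP.
  by field; rewrite gt_eqF.
move=> b0 Zb; apply/lee_addgt0Pr => e e0; rewrite -EFinD; apply: pos; first lra.
by apply: (L2le_le mZ mZ _ _ Zb) => //; lra.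
Qed.

Lemma L2le_mean (Z : T -> R) b : measurable_fun setT Z -> 0 <= b -> L2le P Z b ->
  `|\int[P]_om Z om| <= b.
Proof.
move=> mZ b0 Zb; have iZ := L2le_integrable mZ Zb.
apply: le_trans (le_normr_Rintegral measurableT iZ) _.
have /= := L2le_L1 mZ b0 Zb.
rewrite /Rintegral -lee_fin fineK//.
apply: integrable_fin_num => //.
exact: (integrable_norm iZ).
Qed.

(** Used with c minus the mean of Z to bound variances, and with c the value of
    an independent variable to show orthogonality. *)
Lemma integral_sqr_shift (Z : T -> R) b c : measurable_fun setT Z -> L2le P Z b ->
  (\int[P]_om ((c + Z om) ^+ 2)%:E =
   (c ^+ 2 + 2 * c * (\int[P]_om Z om)%R)%:E + \int[P]_om (Z om ^+ 2)%:E)%E.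
Proof.
move=> mZ Zb; have iZ := L2le_integrable mZ Zb.
have iZ2 := L2le_sqr_integrable mZ Zb.
under eq_integral => om _.
  have -> : (c + Z om) ^+ 2 = (c ^+ 2 + (2 * c) * Z om) + Z om ^+ 2 by ring.
  rewrite EFinD (EFinD (c ^+ 2)) (EFinM (2 * c)).
  over.
have ic : P.-integrable setT (cst (c ^+ 2)%:E).
  exact: finite_measure_integrable_cst.
have icZ : P.-integrable setT (fun om => (2 * c)%:E * (Z om)%:E)%E.
  exact: integrableZl.
rewrite integralD//; last exact: integrableD.
congr (_ + _)%E; rewrite integralD// integralZl// integral_cst//=.
rewrite probability_setT mule1 EFinD (EFinM (2 * c)) /Rintegral fineK//.
exact: integrable_fin_num.
Qed.

Lemma L2le_center (Z : T -> R) b : measurable_fun setT Z -> L2le P Z b ->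
  L2le P (fun om => Z om - \int[P]_w Z w) b.
Proof.
move=> mZ Zb; rewrite /L2le; set e := \int[P]_w Z w.
under eq_integral do rewrite addrC.
rewrite (integral_sqr_shift _ mZ Zb) -/e.
apply: le_trans Zb; rewrite -[leRHS]add0e leeD2r// lee_fin.
have := sqr_ge0 e; nra.
Qed.

Lemma mean_center (Z : T -> R) b : measurable_fun setT Z -> L2le P Z b ->
  \int[P]_om (Z om - \int[P]_w Z w) = 0.
Proof.
move=> mZ Zb; rewrite RintegralB//; last 2 first.
- exact: (L2le_integrable mZ Zb).
- exact: finite_measure_integrable_cst.
by rewrite Rintegral_cst//= probability_setT mulr1 subrr.
Qed.

(** Orthogonality of independent variables, one of them centred: after decoupling,
    the cross term vanishes in the inner integral. *)
Lemma L2_add_indep (G H : set_system T) (Y Z : T -> R) b :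
  G `<=` measurable -> H `<=` measurable -> indep_pair P <<s G >> <<s H >> ->
  measurable_fun [set: g_sigma_algebraType G] Y ->
  measurable_fun [set: g_sigma_algebraType H] Z ->
  L2le P Z b -> \int[P]_om Z om = 0 ->
  (\int[P]_om ((Y om + Z om) ^+ 2)%:E =
   \int[P]_om (Y om ^+ 2)%:E + \int[P]_om (Z om ^+ 2)%:E)%E.
Proof.
move=> Gm Hm GH mY mZ Zb Z0.
have mYT := measurableT_comp mY (measurable_id_gen Gm).
have mZT := measurableT_comp mZ (measurable_id_gen Hm).
transitivity (\int[P]_w1 \int[P]_w2 ((Y w1 + Z w2) ^+ 2)%:E)%E.
  apply: (decouple Gm Hm GH (Psi := fun p => ((Y p.1 + Z p.2) ^+ 2)%:E)).
    apply/measurable_EFinP; apply: measurable_funX; apply: measurable_funD.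
      exact: (measurableT_comp mY measurable_fst).
    exact: (measurableT_comp mZ measurable_snd).
  by move=> z; rewrite lee_fin sqr_ge0.
under eq_integral do rewrite (integral_sqr_shift _ mZT Zb) Z0 mulr0 addr0.
rewrite ge0_integralD//; last 3 first.
- by move=> w1 _; rewrite lee_fin sqr_ge0.
- by apply/measurable_EFinP; exact: measurable_funX.
- by move=> w1 _; apply: integral_ge0 => w2 _; rewrite lee_fin sqr_ge0.
by rewrite integral_cst//= probability_setT mule1.
Qed.

Lemma L2le_cst c b : 0 <= c <= b -> L2le P (cst c) b.
Proof.
move=> /andP[c0 cb]; rewrite /L2le.
rewrite -[X in (X <= _)%E]/(\int[P]_om (cst (c ^+ 2)%:E) om)%E.
rewrite integral_cst//= probability_setT mule1 lee_fin lerXn2r ?nnegrE//.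
exact: le_trans cb.
Qed.

End L2_moments.

Section L2_blocks.
Context d (T : measurableType d) (R : realType) (P : probability T R).
Context (I : choiceType) (F : I -> set_system T).
Hypothesis Fsub : forall i, sub_sigma_algebra_of (F i).
Hypothesis Find : independent_systems P F.

Lemma measurable_block_mono (S S' : set I) d' (U : measurableType d')
    (Z : T -> U) : S `<=` S' ->
  measurable_fun [set: g_sigma_algebraType (block F S)] Z ->
  measurable_fun [set: g_sigma_algebraType (block F S')] Z.
Proof.
move=> SS' mZ _ B mB; have := mZ measurableT B mB; rewrite !setTI.
by apply: sub_sigma_algebra2; exact: block_mono.
Qed.

Lemma measurable_blockT (S : set I) d' (U : measurableType d') (Z : T -> U) :
  measurable_fun [set: g_sigma_algebraType (block F S)] Z ->
  measurable_fun [set: T] Z.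
Proof.
by move=> mZ; exact: (measurableT_comp mZ (measurable_id_gen (block_measurable Fsub (S := S)))).
Qed.

Lemma L2_indep_sum (J : eqType) (s : seq J) (S : J -> set I) (Z : J -> T -> R) b :
  uniq s ->
  (forall j k, j \in s -> k \in s -> j != k -> S j `&` S k = set0) ->
  (forall j, j \in s ->
    measurable_fun [set: g_sigma_algebraType (block F (S j))] (Z j)) ->
  (forall j, j \in s -> \int[P]_om Z j om = 0) ->
  (forall j, j \in s -> L2le P (Z j) b) ->
  (\int[P]_om ((\sum_(j <- s) Z j om) ^+ 2)%:E <= ((size s)%:R * b ^+ 2)%:E)%E.
Proof.
elim: s => [_ _ _ _ _|j s IH /= /andP[js us] SS mZ Z0 Zb].
  under eq_integral do rewrite big_nil expr0n/=.
  by rewrite integral0 mul0r.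
have jj : j \in j :: s by rewrite inE eqxx.
have sub i : i \in s -> i \in j :: s by rewrite inE orbC => ->.
pose S' := \bigcup_(k in [set` s]) S k.
under eq_integral do rewrite big_cons addrC.
rewrite (L2_add_indep (block_measurable Fsub (S := S'))
  (block_measurable Fsub (S := S j)) (b := b)).
- rewrite -natr1 mulrDl mul1r EFinD leeD//; last exact: Zb.
  apply: IH => //.
  - by move=> k l ks ls; apply: SS; exact: sub.
  - by move=> k /sub; exact: mZ.
  - by move=> k /sub; exact: Z0.
  - by move=> k /sub; exact: Zb.
- apply: block_indep => //; rewrite setI_bigcupl bigcup0// => k ks.
  by apply: SS => //; [exact: sub|apply: contra js => /eqP <-].
- have -> : (fun om => \sum_(j <- s) Z j om)%R =
    (fun om => \sum_(j <- s) (if j \in s then Z j om else 0))%R.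
    by apply/funext => om; apply: eq_big_seq => i ->.
  apply: (@measurable_sum _ (g_sigma_algebraType (block F S'))) => i.
  case: (boolP (i \in s)) => [iS|_]; last exact: measurable_cst.
  apply: measurable_block_mono (mZ _ (sub _ iS)).
  exact: (@bigcup_sup _ _ i).
- exact: mZ.
- exact: Zb.
- exact: Z0.
Qed.

(** The Monte Carlo rate: the average of n independent centred samples loses a
    factor sqrt n in the L2 norm. *)
Lemma L2_average (J : eqType) (s : seq J) (S : J -> set I) (Z : J -> T -> R) b :
  uniq s -> (0 < size s)%N -> 0 <= b ->
  (forall j k, j \in s -> k \in s -> j != k -> S j `&` S k = set0) ->
  (forall j, j \in s ->
    measurable_fun [set: g_sigma_algebraType (block F (S j))] (Z j)) ->
  (forall j, j \in s -> L2le P (Z j) b) ->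
  L2le P (fun om => (size s)%:R^-1 * \sum_(j <- s) (Z j om - \int[P]_w Z j w))
    (b / Num.sqrt (size s)%:R).
Proof.
move=> us s0 b0 SS mZ Zb.
have mZT j : j \in s -> measurable_fun setT (Z j).
  by move=> /mZ; exact: measurable_blockT.
have s0' : 0 < (size s)%:R :> R by rewrite ltr0n.
have : L2le P (fun om => \sum_(j <- s) (Z j om - \int[P]_w Z j w))
    (Num.sqrt (size s)%:R * b).
  rewrite /L2le exprMn (sqr_sqrtr (ltW s0')).
  apply: (L2_indep_sum (S := S)) => // j jis.
  - apply: measurable_funB; [exact: mZ|exact: measurable_cst].
  - by apply: mean_center (Zb _ jis); exact: mZT.
  - by apply: L2le_center (Zb _ jis); exact: mZT.
have -> : b / Num.sqrt (size s)%:R = (size s)%:R^-1 * (Num.sqrt (size s)%:R * b).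
  have q0 : 0 < Num.sqrt (size s)%:R :> R by rewrite sqrtr_gt0.
  rewrite -{2}(sqr_sqrtr (ltW s0')); field.
  by rewrite gt_eqF.
apply: L2le_scale.
have -> : (fun om => \sum_(j <- s) (Z j om - \int[P]_w Z j w))%R =
    (fun om => \sum_(j <- s) (if j \in s then (Z j om - \int[P]_w Z j w) else 0))%R.
  by apply/funext => om; apply: eq_big_seq => i ->.
apply: measurable_sum => i; case: (boolP (i \in s)) => [iS|_].
  apply: measurable_funB; [exact: mZT|exact: measurable_cst].
exact: measurable_cst.
Qed.

End L2_blocks.

(** * The supremum norm on a finite set *)

Section supremum_norm.
Context (R : realType) (A : finType).
Implicit Types r s : A -> R.

Lemma supnorm_ge r a : `|r a| <= supnorm r.
Proof. by rewrite /supnorm (bigD1 a)//= le_max lexx. Qed.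

Lemma supnorm_le r b : 0 <= b -> (forall a, `|r a| <= b) -> supnorm r <= b.
Proof.
move=> b0 rb; rewrite /supnorm.
by elim/big_ind : _ => // x y xb yb; rewrite ge_max xb yb.
Qed.

Lemma supnorm_ge0 r : 0 <= supnorm r.
Proof.
rewrite /supnorm; elim/big_ind : _ => // x y x0 y0.
by rewrite le_max x0.
Qed.

Lemma measurable_supnorm d (T : measurableType d) (g : T -> A -> R) :
  (forall a, measurable_fun [set: T] (g ^~ a)) ->
  measurable_fun [set: T] (fun t => supnorm (g t)).
Proof.
move=> mg; rewrite /supnorm.
elim: (index_enum A) => [|a s IH].
  by under eq_fun do rewrite big_nil; exact: measurable_cst.
under eq_fun do rewrite big_cons.
by apply: measurable_maxr => //; apply: measurableT_comp.
Qed.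

End supremum_norm.

(** * Subtrees of the index set *)

Section index_tree.
Implicit Types th : Theta.

Definition tree th : set Theta := [set t | prefix (val th) (val t)].
(** The indices of the randomness that enters V_n^th. *)
Definition desc th : set Theta :=
  [set t | prefix (val th) (val t) && (size (val th) < size (val t))%N].

Lemma desc_tree th : desc th `<=` tree th.
Proof. by move=> t /andP[]. Qed.

Lemma tree_self th : tree th th.
Proof. exact: prefix_refl. Qed.

Lemma prefix_ext th l i : prefix (val th) (val (theta_ext th l i)).
Proof. exact: prefix_prefix. Qed.

Lemma size_ext th l i : size (val (theta_ext th l i)) = (size (val th)).+2.
Proof. by rewrite /= size_cat addn2. Qed.

Lemma tree_ext_desc th l i : tree (theta_ext th l i) `<=` desc th.
Proof.
move=> t /= tp; apply/andP; split.
  exact: prefix_trans (prefix_ext th l i) tp.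
by have := size_prefix tp; rewrite size_cat addn2; apply: ltn_trans.
Qed.

Lemma tree_ext_disj th l i l' i' : (l, i) != (l', i') ->
  tree (theta_ext th l i) `&` tree (theta_ext th l' i') = set0.
Proof.
move=> li; apply/seteqP; split => // t [] /=.
move=> /prefixP[s ts] /prefixP[s' ts'].
move: li; rewrite ts -!catA in ts' => /eqP; apply.
by move: ts' => /eqP; rewrite eqseq_cat// eqxx/= => /eqP[-> -> _].
Qed.

Lemma desc_size th t : (size (val t) <= size (val th))%N -> ~ desc th t.
Proof. by rewrite leqNgt => /negP st /andP[_ /st]. Qed.

(** The indices of the randomness that enters sample i of level l. For l = 0 the
    two subtrees coincide. *)
Definition term_set th (l i : nat) : set Theta :=
  tree (theta_ext th l%:Z i%:Z) `|` tree (theta_ext th (- l%:Z) i%:Z).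

Lemma term_set_disj th l i l' i' : (l, i) != (l', i') ->
  term_set th l i `&` term_set th l' i' = set0.
Proof.
move=> li; rewrite /term_set setIUl !setIUr !tree_ext_disj ?setU0//;
  apply: contra li => /eqP[E1 E2]; apply/eqP; congr (_, _); lia.
Qed.

Lemma term_set_desc th l i : term_set th l i `<=` desc th.
Proof. by move=> t [] /tree_ext_desc. Qed.

End index_tree.

(** * Sums of independent fields *)

Section eqlaw_sums.
Context d (T : measurableType d) (R : realType) (P : probability T R).
Context (I : choiceType) (F : I -> set_system T).
Hypothesis Fsub : forall i, sub_sigma_algebra_of (F i).
Hypothesis Find : independent_systems P F.

Lemma eqlaw_sum (K : Type) (J : eqType) (s : seq J) (S S' : J -> set I)
    (X X' : J -> T -> prod_space K (measurableTypeR R)) :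
  uniq s ->
  (forall i j, i \in s -> j \in s -> i != j -> S i `&` S j = set0) ->
  (forall i j, i \in s -> j \in s -> i != j -> S' i `&` S' j = set0) ->
  (forall j k, j \in s ->
    measurable_fun [set: g_sigma_algebraType (block F (S j))] (X j ^~ k)) ->
  (forall j k, j \in s ->
    measurable_fun [set: g_sigma_algebraType (block F (S' j))] (X' j ^~ k)) ->
  (forall j, j \in s -> eqlaw P (X j) (X' j)) ->
  eqlaw P (fun om => (fun k => \sum_(j <- s) X j om k) :
             prod_space K (measurableTypeR R))
    (fun om => (fun k => \sum_(j <- s) X' j om k)).
Proof.
elim: s => [_ _ _ _ _ _ phi _ _|j s IH /= /andP[js us] SS SS' mX mX' XX'].
  by apply: eq_integral => om _; congr (phi _); apply/funext => k; rewrite !big_nil.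
have jj : j \in j :: s by rewrite inE eqxx.
have sub i : i \in s -> i \in j :: s by rewrite inE orbC => ->.
have tail_disj (U : J -> set I) :
    (forall i k, i \in j :: s -> k \in j :: s -> i != k -> U i `&` U k = set0) ->
    U j `&` \bigcup_(k in [set` s]) U k = set0.
  move=> UU; rewrite setI_bigcupr bigcup0// => k ks.
  by apply: UU => //; [exact: sub|apply: contra js => /eqP ->].
have tail_meas (U : J -> set I) (Z : J -> T -> prod_space K (measurableTypeR R)) k :
    (forall i k, i \in j :: s ->
      measurable_fun [set: g_sigma_algebraType (block F (U i))] (Z i ^~ k)) ->
    measurable_fun [set: g_sigma_algebraType (block F (\bigcup_(k in [set` s]) U k))]
      (fun om => \sum_(j <- s) Z j om k : R).
  move=> mZ; have -> : (fun om => \sum_(j <- s) Z j om k : R) =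
      (fun om => \sum_(j <- s) (if j \in s then Z j om k else 0)).
    by apply/funext => om; apply: eq_big_seq => i ->.
  apply: (@measurable_sum _ (g_sigma_algebraType (block F _))) => i.
  case: (boolP (i \in s)) => [iS|_]; last exact: measurable_cst.
  apply: measurable_block_mono (mZ i k (sub _ iS)).
  exact: (@bigcup_sup _ _ i).
have H := eqlaw_add (block_measurable Fsub (S := S j))
  (block_measurable Fsub (S := \bigcup_(k in [set` s]) S k))
  (block_measurable Fsub (S := S' j))
  (block_measurable Fsub (S := \bigcup_(k in [set` s]) S' k))
  (block_indep Fsub Find (tail_disj _ SS)) (block_indep Fsub Find (tail_disj _ SS'))
  (XX' _ jj) _ (mX j ^~ jj) (fun k => tail_meas S X k mX)
  (mX' j ^~ jj) (fun k => tail_meas S' X' k mX').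
have E (Z : J -> T -> prod_space K (measurableTypeR R)) :
    (fun om => (fun k => \sum_(j <- j :: s) Z j om k) :
       prod_space K (measurableTypeR R)) =
    (fun om => (fun k => (Z j om k : R) + \sum_(j <- s) (Z j om k : R))).
  by apply/funext => om; apply/funext => k; rewrite big_cons.
rewrite !E; apply: H; apply: IH => //.
- by move=> i k /sub ? /sub; exact: SS.
- by move=> i k /sub ? /sub; exact: SS'.
- by move=> i k /sub; exact: mX.
- by move=> i k /sub; exact: mX'.
- by move=> i /sub; exact: XX'.
Qed.

End eqlaw_sums.

(** * The multilevel Picard approximations *)

Section multilevel_picard.
Context (R : realType) (M : nat) (A : finType).
Context dO (Omega : measurableType dO) (P : probability Omega R).
Context dX (X : measurableType dX).
Variable f : X -> (A -> R) -> R.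
Hypothesis fm : measurable_fun [set: X * Rpow A R]
  (fun p : X * Rpow A R => f p.1 p.2).
Variable F : Theta -> set_system Omega.
Hypothesis Fsub : forall th, sub_sigma_algebra_of (F th).
Hypothesis Find : independent_systems P F.
Variable Y : Theta -> X -> Omega -> (A -> X).
Hypothesis Yiid : iid_fields P (Y : Theta -> X -> Omega -> prod_space A X).
Hypothesis Ym : forall th,
  measurable_fun [set: X * g_sigma_algebraType (F th)]
    (fun p : X * g_sigma_algebraType (F th) =>
       Y th p.1 p.2 : prod_space A X).

Notation blk S := (g_sigma_algebraType (block F S)).

Lemma fm_comp d (T : measurableType d) (y : T -> X) (u : T -> A -> R) :
  measurable_fun [set: T] y -> (forall a, measurable_fun [set: T] (u ^~ a)) ->
  measurable_fun [set: T] (fun t => f (y t) (u t)).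
Proof.
move=> my mu.
apply: (measurableT_comp fm (g := fun t => (y t, u t : Rpow A R))).
by apply: measurable_fun_pair => //; exact: measurable_to_prod.
Qed.

Lemma field_mono S S' d (U : measurableType d) (h : X -> Omega -> U) : S `<=` S' ->
  measurable_fun [set: X * blk S] (fun p : X * blk S => h p.1 p.2) ->
  measurable_fun [set: X * blk S'] (fun p : X * blk S' => h p.1 p.2).
Proof.
move=> SS' mh.
apply: (measurableT_comp mh (g := fun p : X * blk S' => (p.1, p.2 : blk S))).
apply: measurable_fun_pair; first exact: measurable_fst.
apply: (measurableT_comp (f := id : blk S' -> blk S)); last exact: measurable_snd.
by apply: measurable_block_mono SS' _; exact: measurable_id.
Qed.

Lemma field_section S d (U : measurableType d) (h : X -> Omega -> U) x :
  measurable_fun [set: X * blk S] (fun p : X * blk S => h p.1 p.2) ->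
  measurable_fun [set: blk S] (h x).
Proof. by move=> mh; exact: (measurable_fun_pair2 x mh). Qed.

Lemma Y_field th a (S : set Theta) : S th -> measurable_fun [set: X * blk S]
  (fun p : X * blk S => Y th p.1 p.2 a).
Proof.
move=> Sth.
have mY := measurable_coord a (@Ym th).
apply: (measurableT_comp mY
  (g := fun p : X * blk S => (p.1, p.2 : g_sigma_algebraType (F th)))).
apply: measurable_fun_pair; first exact: measurable_fst.
apply: (measurableT_comp (f := id : blk S -> g_sigma_algebraType (F th))); last first.
  exact: measurable_snd.
move=> _ B mB; rewrite setTI preimage_id; move: B mB.
by apply: sub_sigma_algebra2 => B FB; exists th.
Qed.

Lemma field_comp th a (S : set Theta) (h : X -> Omega -> R) : S th ->
  measurable_fun [set: X * blk S] (fun p : X * blk S => h p.1 p.2) ->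
  measurable_fun [set: X * blk S] (fun p : X * blk S => h (Y th p.1 p.2 a) p.2).
Proof.
move=> Sth mh.
apply: (measurableT_comp mh (g := fun p : X * blk S => (Y th p.1 p.2 a, p.2))).
by apply: measurable_fun_pair; [exact: Y_field|exact: measurable_snd].
Qed.

Lemma Y_eqlaw th th' :
  eqlaw P (fun om => (fun x => Y th x om) : prod_space X (prod_space A X))
    (fun om => (fun x => Y th' x om)).
Proof.
have [mY _ YY] := Yiid.
by apply: pushforward_eqlaw => // B mB; exact: YY.
Qed.

Variable V : nat -> Theta -> X -> Omega -> (A -> R).
Hypothesis hV : forall (n : nat) (x : X) (a : A) (th : Theta) (om : Omega),
  V n th x om a =
  \sum_(0 <= l < n) ((M ^ (n - l))%:R)^-1 *
    \sum_(1 <= i < (M ^ (n - l)).+1)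
      (let y := Y (theta_ext th l%:Z i%:Z) x om a in
       f y (V l (theta_ext th l%:Z i%:Z) y om)
       - (0 < l)%N%:R *
         f y (V (maxn (l - 1) 0) (theta_ext th (- l%:Z) i%:Z) y om)).

Definition fV n th (y : X) om : R := f y (V n th y om).

(** Kept apart from the random evaluation point, so that the two can be
    decoupled. *)
Definition increment l th th' (y : X) om : R :=
  fV l th y om - (0 < l)%N%:R * fV l.-1 th' y om.

Definition sample l th i (x : X) om a : R :=
  increment l (theta_ext th l%:Z i%:Z) (theta_ext th (- l%:Z) i%:Z)
    (Y (theta_ext th l%:Z i%:Z) x om a) om.

Lemma V_sample n th x om a : V n th x om a =
  \sum_(0 <= l < n) ((M ^ (n - l))%:R)^-1 *
    \sum_(1 <= i < (M ^ (n - l)).+1) sample l th i x om a.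
Proof.
rewrite hV; apply: eq_bigr => l _; congr (_ * _); apply: eq_bigr => i _.
by rewrite /sample /increment /fV maxn0 subn1.
Qed.

Definition V_measurable n := forall th a,
  measurable_fun [set: X * blk (desc th)] (fun p : X * blk (desc th) => V n th p.1 p.2 a).

Lemma fV_field n th : V_measurable n -> measurable_fun [set: X * blk (desc th)]
  (fun p : X * blk (desc th) => fV n th p.1 p.2).
Proof. by move=> mV; apply: fm_comp => //; exact: measurable_fst. Qed.

Lemma increment_field l th th' : V_measurable l -> V_measurable l.-1 ->
  measurable_fun [set: X * blk (desc th `|` desc th')]
    (fun p : X * blk (desc th `|` desc th') => increment l th th' p.1 p.2).
Proof.
move=> mVl mVl'; apply: measurable_funB.
  by apply: (field_mono (h := fV l th) _ (fV_field mVl)) => t; left.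
apply: measurable_funM; first exact: measurable_cst.
by apply: (field_mono (h := fV l.-1 th') _ (fV_field mVl')) => t; right.
Qed.

Lemma sample_field l th i a : V_measurable l -> V_measurable l.-1 ->
  measurable_fun [set: X * blk (term_set th l i)]
    (fun p : X * blk (term_set th l i) => sample l th i p.1 p.2 a).
Proof.
move=> mVl mVl'; apply: (field_comp a (h := increment l _ _)).
  by left; exact: tree_self.
apply: (field_mono (h := increment l _ _) _ (increment_field mVl mVl')) => t.
by move=> [|] /desc_tree; [left|right].
Qed.

(** Strong induction over the recursion; V_n^th at x is a measurable function of
    x and of the randomness strictly below th only. The independence of V_l^th
    from Y^th rests on this strictness. *)
Lemma V_jointly_measurable n : V_measurable n.
Proof.
elim/ltn_ind: n => n IH th a.
under eq_fun do rewrite V_sample.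
have -> : (fun p : X * blk (desc th) => \sum_(0 <= l < n) ((M ^ (n - l))%:R)^-1 *
      \sum_(1 <= i < (M ^ (n - l)).+1) sample l th i p.1 p.2 a) =
    (fun p => \sum_(l < n) ((M ^ (n - l))%:R)^-1 *
      \sum_(1 <= i < (M ^ (n - l)).+1) sample l th i p.1 p.2 a).
  by apply/funext => p; rewrite big_mkord.
apply: measurable_sum => l; apply: measurable_funM; first exact: measurable_cst.
apply: measurable_sum => i.
apply: (field_mono (h := fun x om => sample l th i x om a) (@term_set_desc th l i)).
apply: sample_field; first exact: IH.
by apply: IH; rewrite (leq_ltn_trans (leq_pred _)).
Qed.

Definition V_law n := forall th th',
  eqlaw P
    (fun om => (fun k => V n th k.1 om k.2) : prod_space (X * A) (measurableTypeR R))
    (fun om => (fun k => V n th' k.1 om k.2)).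

Lemma fV_law n th th' : V_law n ->
  eqlaw P (fun om => (fun x => fV n th x om) : prod_space X (measurableTypeR R))
    (fun om => (fun x => fV n th' x om)).
Proof.
move=> lV.
pose h (u : prod_space (X * A) (measurableTypeR R)) : prod_space X (measurableTypeR R)
  := fun x => f x (fun a => u (x, a)).
have mh : measurable_fun setT h.
  apply: measurable_to_prod => x; apply: fm_comp; first exact: measurable_cst.
  by move=> a; exact: measurable_eval.
exact: (eqlaw_comp mh (lV th th')).
Qed.

(** At level 0 the two subtrees coincide, but the second term is multiplied by 0;
    at positive levels they are disjoint and [eqlaw_add] applies. *)
Lemma increment_law l th1 th1' th2 th2' : V_law l -> V_law l.-1 ->
  ((0 < l)%N -> desc th1 `&` desc th1' = set0) ->
  ((0 < l)%N -> desc th2 `&` desc th2' = set0) ->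
  eqlaw P
    (fun om => (fun x => increment l th1 th1' x om) : prod_space X (measurableTypeR R))
    (fun om => (fun x => increment l th2 th2' x om)).
Proof.
move=> lVl lVl' d1 d2; have [l0|l0] := posnP l.
  have E th th' : (fun om => (fun x => increment l th th' x om) :
      prod_space X (measurableTypeR R)) = (fun om => (fun x => fV l th x om)).
    by apply/funext => om; apply/funext => x; rewrite /increment l0 mul0r subr0.
  by rewrite !E; exact: fV_law.
have E th th' : (fun om => (fun x => increment l th th' x om) :
      prod_space X (measurableTypeR R)) =
    (fun om => (fun x => fV l th x om + (- fV l.-1 th' x om))).
  by apply/funext => om; apply/funext => x; rewrite /increment l0 mul1r.
have lN : eqlaw P (fun om => (fun x => - fV l.-1 th1' x om) :
      prod_space X (measurableTypeR R)) (fun om => (fun x => - fV l.-1 th2' x om)).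
  pose h (u : prod_space X (measurableTypeR R)) : prod_space X (measurableTypeR R)
    := fun x => - (u x : R).
  have mh : measurable_fun setT h.
    by apply: measurable_to_prod => x; apply: measurable_funN; exact: measurable_eval.
  exact: (eqlaw_comp mh (fV_law th1' th2' lVl')).
rewrite !E; apply: (eqlaw_add (block_measurable Fsub (S := desc th1))
  (block_measurable Fsub (S := desc th1')) (block_measurable Fsub (S := desc th2))
  (block_measurable Fsub (S := desc th2'))) => //.
- exact: (block_indep Fsub Find (d1 l0)).
- exact: (block_indep Fsub Find (d2 l0)).
- exact: fV_law.
- by move=> x; apply: field_section; apply: fV_field; exact: V_jointly_measurable.
- move=> x; apply: measurable_funN; apply: field_section; apply: fV_field.
  exact: V_jointly_measurable.
- by move=> x; apply: field_section; apply: fV_field; exact: V_jointly_measurable.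
- move=> x; apply: measurable_funN; apply: field_section; apply: fV_field.
  exact: V_jointly_measurable.
Qed.

Lemma indep_Y th (S : set Theta) : ~ S th ->
  indep_pair P <<s block F [set th] >> <<s block F S >>.
Proof.
move=> Sth; apply: block_indep => //; apply/seteqP; split => // t [/= ->].
exact: Sth.
Qed.

(** The instance of [eqlaw_field_comp] for fields driven by index sets that avoid
    the index of the evaluation point. *)
Lemma field_comp_law (h h' : X -> Omega -> R) S S' th th' :
  ~ S th -> ~ S' th' ->
  measurable_fun [set: X * blk S] (fun p : X * blk S => h p.1 p.2) ->
  measurable_fun [set: X * blk S'] (fun p : X * blk S' => h' p.1 p.2) ->
  eqlaw P (fun om => (fun x => h x om) : prod_space X (measurableTypeR R))
    (fun om => (fun x => h' x om)) ->
  eqlaw P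
    (fun om => (fun k => h (Y th k.1 om k.2) om) : prod_space (X * A) (measurableTypeR R))
    (fun om => (fun k => h' (Y th' k.1 om k.2) om)).
Proof.
move=> Sth Sth' mh mh' hh'.
apply: (eqlaw_field_comp (block_measurable Fsub (S := [set th]))
  (block_measurable Fsub (S := S)) (block_measurable Fsub (S := [set th']))
  (block_measurable Fsub (S := S')) (indep_Y Sth) (indep_Y Sth')
  (Y := Y th) (Y' := Y th') (h := h) (h' := h')) => //.
- exact: Y_eqlaw.
- by move=> x a; apply: (field_section (h := fun x om => Y th x om a)); exact: Y_field.
- by move=> x a; apply: (field_section (h := fun x om => Y th' x om a)); exact: Y_field.
Qed.

Lemma sample_law l th th' i : V_law l -> V_law l.-1 ->
  eqlaw P
    (fun om => (fun k => sample l th i k.1 om k.2) :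
       prod_space (X * A) (measurableTypeR R))
    (fun om => (fun k => sample l th' i k.1 om k.2)).
Proof.
move=> lVl lVl'.
have out t : ~ (desc (theta_ext t l i) `|` desc (theta_ext t (- l%:Z) i))
    (theta_ext t l i).
  by move=> [|]; apply: desc_size; rewrite !size_ext.
apply: (field_comp_law (out th) (out th')
  (h := increment l (theta_ext th l%:Z i%:Z) (theta_ext th (- l%:Z) i%:Z))
  (h' := increment l (theta_ext th' l%:Z i%:Z) (theta_ext th' (- l%:Z) i%:Z))).
- by apply: increment_field; exact: V_jointly_measurable.
- by apply: increment_field; exact: V_jointly_measurable.
have dd t : (0 < l)%N ->
    desc (theta_ext t l%:Z i%:Z) `&` desc (theta_ext t (- l%:Z) i%:Z) = set0.
  move=> l0; apply/seteqP; split => // s [/desc_tree H1 /desc_tree H2].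
  have <- := @tree_ext_disj t l i (- l%:Z) i _; first by split.
  by apply/eqP => -[]; lia.
exact: (increment_law lVl lVl' (dd th) (dd th')).
Qed.

(** Strong induction: V_n^th is a sum of independent samples, each of which is an
    increment of earlier levels at an independent random point. *)
Lemma V_same_law n : V_law n.
Proof.
elim/ltn_ind: n => n IH th th'.
(* The double sum over levels and samples, flattened to a sum over pairs (l, i). *)
pose s := [seq (l, i) | l <- index_iota 0 n, i <- index_iota 1 (M ^ (n - l)).+1].
pose c (l : nat) : R := ((M ^ (n - l))%:R)^-1.
pose Z t (j : nat * nat) om : prod_space (X * A) (measurableTypeR R) :=
  fun k => c j.1 * sample j.1 t j.2 k.1 om k.2.
have E t : (fun om => (fun k => V n t k.1 om k.2) :
      prod_space (X * A) (measurableTypeR R)) =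
    (fun om => (fun k => \sum_(j <- s) Z t j om k)).
  apply/funext => om; apply/funext => k; rewrite V_sample.
  rewrite big_allpairs_dep/=; apply: eq_bigr => l _.
  by rewrite mulr_sumr.
have sP j : j \in s -> (j.1 < n)%N.
  by move=> /allpairsPdep[l [i [+ _ ->]]]; rewrite mem_index_iota.
rewrite !E; apply: (eqlaw_sum Fsub Find (S := fun j => term_set th j.1 j.2)
  (S' := fun j => term_set th' j.1 j.2)).
- apply: allpairs_uniq_dep; [exact: iota_uniq|by move=> *; exact: iota_uniq|].
  by move=> [x1 x2] [y1 y2] _ _ /= [-> ->].
- by move=> [? ?] [? ?] _ _; exact: term_set_disj.
- by move=> [? ?] [? ?] _ _; exact: term_set_disj.
- move=> j k _; apply: measurable_funM; first exact: measurable_cst.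
  apply: (field_section (h := fun x om => sample j.1 th j.2 x om k.2)).
  by apply: sample_field; exact: V_jointly_measurable.
- move=> j k _; apply: measurable_funM; first exact: measurable_cst.
  apply: (field_section (h := fun x om => sample j.1 th' j.2 x om k.2)).
  by apply: sample_field; exact: V_jointly_measurable.
move=> j /sP jn.
pose h (u : prod_space (X * A) (measurableTypeR R)) :
  prod_space (X * A) (measurableTypeR R) := fun k => c j.1 * (u k : R).
have mh : measurable_fun setT h.
  apply: measurable_to_prod => k; apply: measurable_funM; first exact: measurable_cst.
  exact: measurable_eval.
apply: (eqlaw_comp mh (sample_law th th' j.2 _ _)); first exact: IH.
by apply: IH; rewrite (leq_ltn_trans (leq_pred _)).
Qed.

Variables (w : X -> R) (kappa lam L : R).
Hypothesis w0 : forall x, 0 < w x.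
Hypothesis wm : measurable_fun [set: X] w.
Hypothesis kappa0 : 0 <= kappa.
Hypothesis lam0 : 0 <= lam.
Hypothesis L0 : 0 <= L.
Hypothesis fLip : forall (x : X) (r s : A -> R),
  `|f x r - f x s| <= L * supnorm (fun b => r b - s b).
Hypothesis f0L2 : forall (x : X) (a : A),
  L2le P (fun om => f (Y theta0 x om a) (fun=> 0)) (kappa * w x).
Hypothesis wL2 : forall (x : X) (a : A),
  L2le P (fun om => w (Y theta0 x om a)) (lam * w x).

Lemma Y_measurable th x a : measurable_fun [set: Omega] (fun om => Y th x om a).
Proof.
apply: (measurable_blockT Fsub (S := [set th])).
by apply: (field_section (h := fun x om => Y th x om a)); exact: Y_field.
Qed.

Lemma L2le_Y (g : X -> R) th x a b : measurable_fun [set: X] g ->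
  L2le P (fun om => g (Y theta0 x om a)) b -> L2le P (fun om => g (Y th x om a)) b.
Proof.
move=> mg; rewrite /L2le.
pose phi (u : prod_space X (prod_space A X)) := ((g (u x a)) ^+ 2)%:E.
have mphi : measurable_fun setT phi.
  apply/measurable_EFinP; apply: measurable_funX.
  apply: (measurableT_comp mg); exact: (measurable_coord a (measurable_eval x)).
have := Y_eqlaw theta0 th mphi; rewrite /phi => -> //.
by move=> u; rewrite lee_fin sqr_ge0.
Qed.

Lemma mean_Y (g : X -> R) th x a : measurable_fun [set: X] g ->
  \int[P]_om g (Y th x om a) = \int[P]_om g (Y theta0 x om a).
Proof.
move=> mg; rewrite /Rintegral.
pose phi (u : prod_space X (prod_space A X)) := (g (u x a))%:E.
have mphi : measurable_fun setT phi.
  apply/measurable_EFinP.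
  apply: (measurableT_comp mg); exact: (measurable_coord a (measurable_eval x)).
by congr fine; exact: (eqlaw_integral mphi (Y_eqlaw th theta0)).
Qed.

Lemma wY_L2 th x a : L2le P (fun om => w (Y th x om a)) (lam * w x).
Proof. exact: L2le_Y. Qed.

Lemma f0_measurable : measurable_fun [set: X] (fun x => f x (fun=> 0)).
Proof. by apply: fm_comp => //; exact: measurable_id. Qed.

Lemma f0Y_L2 th x a : L2le P (fun om => f (Y th x om a) (fun=> 0)) (kappa * w x).
Proof. by apply: (L2le_Y (g := fun x => f x (fun=> 0))) => //; exact: f0_measurable. Qed.

(** Decouple the field from the evaluation point, use the bound on h at the frozen
    point, and integrate w^2 at the random point. *)
Lemma L2le_field_comp (h : X -> Omega -> R) (S : set Theta) th e x a :
  ~ S th ->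
  measurable_fun [set: X * blk S] (fun p : X * blk S => h p.1 p.2) -> 0 <= e ->
  (forall y, L2le P (h y) (e * w y)) ->
  L2le P (fun om => h (Y th x om a) om) (e * (lam * w x)).
Proof.
move=> Sth mh e0 he.
have mY : measurable_fun [set: blk [set th]] (fun om => Y th x om a).
  by apply: (field_section (h := fun x om => Y th x om a)); exact: Y_field.
have mYT := Y_measurable th x a.
apply: (@le_trans _ _ (\int[P]_w1 \int[P]_w2 ((h (Y th x w1 a) w2) ^+ 2)%:E)%E).
  rewrite le_eqVlt; apply/orP; left; apply/eqP.
  apply: (decouple (block_measurable Fsub (S := [set th]))
    (block_measurable Fsub (S := S)) (indep_Y Sth)
    (Psi := fun p => ((h (Y th x p.1 a) p.2) ^+ 2)%:E)).
    apply/measurable_EFinP; apply: measurable_funX.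
    apply: (measurableT_comp mh
      (g := fun p : blk [set th] * blk S => (Y th x p.1 a, p.2))).
    apply: measurable_fun_pair; last exact: measurable_snd.
    exact: (measurableT_comp mY measurable_fst).
  by move=> z; rewrite lee_fin sqr_ge0.
apply: (@le_trans _ _ (\int[P]_w1 ((e * w (Y th x w1 a)) ^+ 2)%:E)%E); last first.
  apply: (L2le_scale e _ (wY_L2 th x a)).
  exact: (measurableT_comp wm).
apply: ge0_le_integral => //.
- by move=> w1 _; apply: integral_ge0 => w2 _; rewrite lee_fin sqr_ge0.
- have mhT : measurable_fun [set: X * Omega] (fun p : X * Omega => h p.1 p.2).
    apply: (measurableT_comp mh (g := fun p : X * Omega => (p.1, p.2 : blk S))).
    apply: measurable_fun_pair; first exact: measurable_fst.
    apply: (measurableT_comp (measurable_id_gen (block_measurable Fsub (S := S)))).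
    exact: measurable_snd.
  have := measurable_fun_fubini_tonelli_F (m2 := P)
    (fun p : Omega * Omega => ((h (Y th x p.1 a) p.2) ^+ 2)%:E).
  apply; last by move=> p; rewrite lee_fin sqr_ge0.
  apply/measurable_EFinP; apply: measurable_funX.
  apply: (measurableT_comp mhT (g := fun p : Omega * Omega => (Y th x p.1 a, p.2))).
  apply: measurable_fun_pair; last exact: measurable_snd.
  exact: (measurableT_comp mYT measurable_fst).
- apply/measurable_EFinP; apply: measurable_funX; apply: measurable_funM => //.
  exact: (measurableT_comp wm).
- by move=> w1 _; exact: he.
Qed.

Lemma fu_measurable (u : X -> A -> R) : (forall a, measurable_fun [set: X] (u ^~ a)) ->
  measurable_fun [set: X] (fun x => f x (u x)).
Proof. by move=> mu; apply: fm_comp => //; exact: measurable_id. Qed.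

(** From |f(y, u(y))| <= |f(y, 0)| + L |u(y)|_infty. *)
Lemma fuY_L2 (u : X -> A -> R) b th x a :
  (forall a, measurable_fun [set: X] (u ^~ a)) -> 0 <= b ->
  (forall x, supnorm (u x) <= b * w x) ->
  L2le P (fun om => f (Y th x om a) (u (Y th x om a)))
    (kappa * w x + L * b * (lam * w x)).
Proof.
move=> mu b0 ub.
have mYT := Y_measurable th x a.
have mf0 := measurableT_comp f0_measurable mYT.
have mw := measurableT_comp wm mYT.
have kw0 : 0 <= kappa * w x by rewrite mulr_ge0// ltW.
have LB0 : 0 <= L * b by rewrite mulr_ge0.
have lw0 : 0 <= lam * w x by rewrite mulr_ge0// ltW.
have LW := L2le_scale (L * b) mw (wY_L2 th x a).
have mfa : measurable_fun [set: Omega] (fun om => `|f (Y th x om a) (fun=> 0)|).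
  exact: measurableT_comp.
have F0 : L2le P (fun om => `|f (Y th x om a) (fun=> 0)|) (kappa * w x).
  apply: (L2le_le mfa mf0 _ _ (f0Y_L2 th x a)); last by rewrite kw0 lexx.
  by move=> om; rewrite normr_id.
have mLW : measurable_fun [set: Omega] (fun om => L * b * w (Y th x om a)).
  exact: measurable_funM.
have H := L2le_add mfa mLW kw0 (mulr_ge0 LB0 lw0) F0 LW.
apply: (L2le_le _ _ _ _ H).
- exact: (measurableT_comp (fu_measurable mu) mYT).
- exact: measurable_funD.
- move=> om; set y := Y th x om a.
  have LBw : 0 <= L * b * w y by rewrite mulr_ge0// ltW.
  rewrite (@ger0_norm _ (_ + _)) ?addr_ge0//.
  rewrite -[X in `|X| <= _](subrK (f y (fun=> 0))) [leRHS]addrC.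
  apply: le_trans (ler_normD _ _) _; rewrite lerD2r.
  apply: le_trans (fLip _ _ _) _; rewrite -mulrA ler_wpM2l//.
  by under eq_fun do rewrite subr0; exact: ub.
- by rewrite lexx andbT addr_ge0// mulr_ge0.
Qed.

(** * The stochastic fixed point equation *)

Section fixed_point.
Hypothesis q1 : L * lam < 1.
Let q := L * lam.
Let Y0 := Y theta0.

Let q0 : 0 <= q. Proof. exact: mulr_ge0. Qed.

Definition solves (v : X -> A -> R) (b : R) : Prop :=
  [/\ forall a, measurable_fun [set: X] (v ^~ a), 0 <= b,
      forall x, supnorm (v x) <= b * w x &
      forall x a, v x a = \int[P]_om f (Y0 x om a) (v (Y0 x om a))].

Definition picard (u : X -> A -> R) x a : R :=
  \int[P]_om f (Y0 x om a) (u (Y0 x om a)).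

Lemma fuY_integrable (u : X -> A -> R) b x a :
  (forall a, measurable_fun [set: X] (u ^~ a)) -> 0 <= b ->
  (forall x, supnorm (u x) <= b * w x) ->
  P.-integrable setT (fun om => (f (Y0 x om a) (u (Y0 x om a)))%:E).
Proof.
move=> mu b0 ub; apply: L2le_integrable (fuY_L2 theta0 x a mu b0 ub).
exact: (measurableT_comp (fu_measurable mu) (Y_measurable theta0 x a)).
Qed.

Lemma picard_bound (u : X -> A -> R) b :
  (forall a, measurable_fun [set: X] (u ^~ a)) -> 0 <= b ->
  (forall x, supnorm (u x) <= b * w x) ->
  forall x, supnorm (picard u x) <= (kappa + q * b) * w x.
Proof.
move=> mu b0 ub x; have w0x := ltW (w0 x).
apply: supnorm_le => [|a]; first by rewrite mulr_ge0// addr_ge0// mulr_ge0.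
have -> : (kappa + q * b) * w x = kappa * w x + L * b * (lam * w x).
  by rewrite /q; ring.
apply: L2le_mean; last exact: fuY_L2.
  exact: (measurableT_comp (fu_measurable mu) (Y_measurable theta0 x a)).
by rewrite addr_ge0// ?mulr_ge0.
Qed.

(** Contraction in the w-weighted norm, stated for bounds c valid at all points. *)
Lemma picard_contract (u1 u2 : X -> A -> R) b1 b2 c :
  (forall a, measurable_fun [set: X] (u1 ^~ a)) -> 0 <= b1 ->
  (forall x, supnorm (u1 x) <= b1 * w x) ->
  (forall a, measurable_fun [set: X] (u2 ^~ a)) -> 0 <= b2 ->
  (forall x, supnorm (u2 x) <= b2 * w x) -> 0 <= c ->
  (forall x a, `|u1 x a - u2 x a| <= c * w x) ->
  forall x a, `|picard u1 x a - picard u2 x a| <= q * c * w x.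
Proof.
move=> mu1 b10 ub1 mu2 b20 ub2 c0 uc x a.
have i1 := fuY_integrable x a mu1 b10 ub1.
have i2 := fuY_integrable x a mu2 b20 ub2.
rewrite /picard -RintegralB//.
have mYx := Y_measurable theta0 x a.
have mw : measurable_fun [set: Omega] (fun om => L * c * w (Y0 x om a)).
  by apply: measurable_funM => //; exact: (measurableT_comp wm mYx).
have mf : measurable_fun [set: Omega]
    (fun om => f (Y0 x om a) (u1 (Y0 x om a)) - f (Y0 x om a) (u2 (Y0 x om a))).
  by apply: measurable_funB; [exact: (measurableT_comp (fu_measurable mu1) mYx)|
    exact: (measurableT_comp (fu_measurable mu2) mYx)].
have bound0 : 0 <= L * c * (lam * w x) by rewrite !mulr_ge0// ltW.
have -> : q * c * w x = L * c * (lam * w x) by rewrite /q; ring.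
apply: L2le_mean => //.
apply: (L2le_le mf mw _ _ (L2le_scale (L * c) _ (wL2 x a))).
- move=> om; set y := Y0 x om a.
  have wy : 0 <= w y by exact: ltW.
  rewrite [leRHS]ger0_norm ?mulr_ge0//.
  apply: le_trans (fLip _ _ _) _; rewrite -mulrA ler_wpM2l//.
  by apply: supnorm_le => [|b]; [exact: mulr_ge0|exact: uc].
- by rewrite bound0 lexx.
- exact: (measurableT_comp wm mYx).
Qed.

(** Tonelli gives measurability of the integrals of the positive and negative
    parts; the integral is their difference. *)
Lemma picard_measurable (u : X -> A -> R) :
  (forall a, measurable_fun [set: X] (u ^~ a)) ->
  forall a, measurable_fun [set: X] (picard u ^~ a).
Proof.
move=> mu a.
pose g (p : X * Omega) := (f (Y0 p.1 p.2 a) (u (Y0 p.1 p.2 a)))%:E.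
have mg : measurable_fun [set: X * Omega] g.
  apply/measurable_EFinP.
  apply: (measurableT_comp (fu_measurable mu) (g := fun p : X * Omega => Y0 p.1 p.2 a)).
  have mY : measurable_fun [set: X * blk [set theta0]]
      (fun p : X * blk [set theta0] => Y theta0 p.1 p.2 a) by exact: Y_field.
  apply: (measurableT_comp mY
    (g := fun p : X * Omega => (p.1, p.2 : blk [set theta0]))).
  apply: measurable_fun_pair; first exact: measurable_fst.
  apply: (measurableT_comp (measurable_id_gen (block_measurable Fsub (S := [set theta0])))).
  exact: measurable_snd.
apply: (measurableT_comp (f := fine)).
  by apply: fine_measurable.
have -> : (fun x => \int[P]_om (f (Y0 x om a) (u (Y0 x om a)))%:E)%E =
    (fun x => \int[P]_om g^\+ (x, om) - \int[P]_om g^\- (x, om))%E.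
  apply/funext => x; rewrite integralE; congr (_ - _)%E; apply: eq_integral => om _.
    by rewrite !funeposE.
  by rewrite !funenegE.
apply: emeasurable_funB.
  by apply: (measurable_fun_fubini_tonelli_F (m2 := P) _ (measurable_funepos mg)).
by apply: (measurable_fun_fubini_tonelli_F (m2 := P) _ (measurable_funeneg mg)).
Qed.

(** Inequalities proved along the Picard iteration hold up to c q^n for every n. *)
Lemma geometric_limit (x y c : R) : 0 <= c -> (forall n, x <= y + c * q ^+ n) -> x <= y.
Proof.
move=> c0 H; apply/ler_addgt0Pr => e e0.
have qn : `|q| < 1 by rewrite ger0_norm.
have /cvgrPdist_lt /(_ _ e0) := cvg_geometric c qn.
move=> [n _ /(_ n (leqnn _))]; rewrite /= sub0r normrN => cn.
apply: le_trans (H n) _; rewrite lerD2l.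
exact: le_trans (ler_norm _) (ltW cn).
Qed.

(** Iterating [picard_bound] replaces the unknown constant b by
    kappa / (1 - q) + b q^n. This makes the bound on v uniform in all data with
    the same kappa and q. *)
Lemma solves_bound v b : solves v b -> forall x, supnorm (v x) <= kappa / (1 - q) * w x.
Proof.
move=> [mv b0 vb ve]; have q1' : 0 < 1 - q by rewrite subr_gt0.
have k0 : 0 <= kappa / (1 - q) by rewrite divr_ge0// ltW.
have vp : v = picard v by apply/funext => x; apply/funext => a; rewrite {1}ve.
have H n x : supnorm (v x) <= (kappa / (1 - q) + b * q ^+ n) * w x.
  elim: n x => [|n IH] x.
    apply: le_trans (vb x) _; rewrite ler_wpM2r ?(ltW (w0 x))//.
    by rewrite expr0 mulr1 lerDr.
  have c0 : 0 <= kappa / (1 - q) + b * q ^+ n by rewrite addr_ge0// mulr_ge0// exprn_ge0.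
  rewrite {1}vp; apply: le_trans (picard_bound mv c0 IH x) _.
  rewrite ler_wpM2r ?(ltW (w0 x))// le_eqVlt exprS; apply/orP; left; apply/eqP.
  by field; rewrite gt_eqF.
move=> x; apply: (@geometric_limit _ _ (b * w x)); first by rewrite mulr_ge0// ltW.
by move=> n; apply: le_trans (H n x) _; rewrite mulrDl -!mulrA (mulrC (w x)).
Qed.

Lemma solves_unique v1 v2 b1 b2 : solves v1 b1 -> solves v2 b2 -> v1 = v2.
Proof.
move=> s1 s2; have [mv1 b10 vb1 ve1] := s1; have [mv2 b20 vb2 ve2] := s2.
have vp1 : v1 = picard v1 by apply/funext => x; apply/funext => a; rewrite {1}ve1.
have vp2 : v2 = picard v2 by apply/funext => x; apply/funext => a; rewrite {1}ve2.
have H n x a : `|v1 x a - v2 x a| <= (b1 + b2) * q ^+ n * w x.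
  elim: n x a => [|n IH] x a.
    rewrite mulr1 mulrDl; apply: le_trans (ler_normB _ _) _.
    by rewrite lerD//; apply: le_trans (supnorm_ge _ _) _.
  rewrite {1}vp1 {1}vp2 exprS mulrCA.
  apply: (picard_contract mv1 b10 vb1 mv2 b20 vb2) => //.
  by rewrite mulr_ge0 ?addr_ge0 ?exprn_ge0.
apply/funext => x; apply/funext => a; apply/eqP; rewrite -subr_eq0 -normr_le0.
apply: (@geometric_limit _ _ ((b1 + b2) * w x)).
  by rewrite mulr_ge0 ?addr_ge0// ltW.
by move=> n; rewrite add0r mulrAC; exact: H.
Qed.

Let iterate n : X -> A -> R := iter n picard (fun _ _ => 0).
Let K := kappa / (1 - q).

(** Consecutive iterates differ by at most kappa q^n w, so the iterates lowered by
    the remaining geometric tail K q^n w increase, and raised by it decrease.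
    Their common limit v differs from the n-th iterate by at most K q^n w. *)
Lemma solves_exists : exists v, solves v K.
Proof.
have q1' : 0 < 1 - q by rewrite subr_gt0.
have K0 : 0 <= K by rewrite divr_ge0// ltW.
have it n : (forall a, measurable_fun [set: X] (iterate n ^~ a)) /\
    (forall x, supnorm (iterate n x) <= K * w x).
  elim: n => [|n [mI bI]].
    split=> [a|x]; first exact: measurable_cst.
    have Kw0 := mulr_ge0 K0 (ltW (w0 x)).
    by apply: supnorm_le => // a; rewrite /= normr0.
  split; first exact: picard_measurable.
  move=> x; apply: le_trans (picard_bound mI K0 bI x) _.
  rewrite ler_wpM2r ?(ltW (w0 x))// le_eqVlt; apply/orP; left; apply/eqP.
  by rewrite /K; field; rewrite gt_eqF.
have mI n := (it n).1; have bI n := (it n).2.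
have step n x a : `|iterate n.+1 x a - iterate n x a| <= kappa * q ^+ n * w x.
  elim: n x a => [|n IH] x a.
    rewrite /= subr0 mulr1; apply: le_trans (supnorm_ge _ _) _.
    have z0 y : supnorm ((fun _ => 0) : A -> R) <= 0 * w y.
      by rewrite mul0r; apply: supnorm_le => // b; rewrite normr0.
    have := picard_bound (u := fun _ _ => 0) (b := 0) _ _ z0 x.
    by rewrite mulr0 addr0; apply.
  rewrite exprS mulrCA.
  apply: (picard_contract (mI n.+1) K0 (bI n.+1) (mI n) K0 (bI n)) => //.
  by rewrite mulr_ge0 ?exprn_ge0.
pose lo x a n := iterate n x a - K * q ^+ n * w x.
pose hi x a n := iterate n x a + K * q ^+ n * w x.
have Kstep n x : K * q ^+ n * w x - K * q ^+ n.+1 * w x = kappa * q ^+ n * w x.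
  by rewrite /K exprS; field; rewrite gt_eqF.
have lo_nd x a : nondecreasing_seq (lo x a).
  apply/nondecreasing_seqP => n; rewrite /lo.
  have := step n x a; rewrite ler_norml -Kstep; lra.
have hi_ni x a : nonincreasing_seq (hi x a).
  apply/nonincreasing_seqP => n; rewrite /hi.
  have := step n x a; rewrite ler_norml -Kstep; lra.
have lohi x a m n : lo x a m <= hi x a n.
  have lh k : lo x a k <= hi x a k.
    have := mulr_ge0 (mulr_ge0 K0 (exprn_ge0 k q0)) (ltW (w0 x)).
    by rewrite /lo /hi; lra.
  apply: le_trans (lo_nd x a _ _ (leq_maxl m n)) _.
  exact: le_trans (lh _) (hi_ni x a _ _ (leq_maxr m n)).
have ubd x a : has_ubound (range (lo x a)).
  by exists (hi x a 0%N) => _ [m _ <-]; exact: lohi.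
pose v x a := sup (range (lo x a)).
have vcvg x a : lo x a @ \oo --> v x a by exact: nondecreasing_cvgn.
have vnear n x a : `|iterate n x a - v x a| <= K * q ^+ n * w x.
  have H1 : lo x a n <= v x a by apply: ub_le_sup => //; exists n.
  have H2 : v x a <= hi x a n.
    by apply: ge_sup => [|_ [m _ <-]]; [exists (lo x a 0%N); exists 0%N|exact: lohi].
  by rewrite ler_norml; move: H1 H2; rewrite /lo /hi; lra.
have mv a : measurable_fun [set: X] (v ^~ a).
  apply: (@measurable_fun_cvg _ X R setT (fun n x => lo x a n)) => [n|x _].
    apply: measurable_funB; first exact: mI.
    by apply: measurable_funM => //; exact: measurable_cst.
  exact: vcvg.
have vK x : supnorm (v x) <= K * w x.
  have w0x := ltW (w0 x).
  apply: supnorm_le => [|a]; first exact: mulr_ge0.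
  apply: (@geometric_limit _ _ (K * w x)); first exact: mulr_ge0.
  move=> n; rewrite -[X in `|X| <= _](subrK (iterate n x a)) addrC.
  apply: le_trans (ler_normD _ _) _; rewrite lerD//.
    exact: le_trans (supnorm_ge _ _) (bI n x).
  by rewrite distrC mulrAC; exact: vnear.
exists v; split => // x a.
apply/eqP; rewrite -subr_eq0 -normr_le0.
apply: (@geometric_limit _ _ (2 * (K * w x))).
  exact: mulr_ge0 (ler0n _ 2) (mulr_ge0 K0 (ltW (w0 x))).
move=> n; rewrite add0r.
have Kqn : 0 <= K * q ^+ n by rewrite mulr_ge0 ?exprn_ge0.
have H1 := vnear n.+1 x a.
have H2 := picard_contract (mI n) K0 (bI n) mv K0 vK Kqn (vnear n) x a.
have H3 : q * (K * q ^+ n) * w x <= K * q ^+ n * w x.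
  by rewrite ler_wpM2r ?(ltW (w0 x))// ler_piMl// ltW.
have H4 : K * q ^+ n.+1 * w x <= K * q ^+ n * w x by rewrite exprS mulrCA.
rewrite -/(picard v x a) -(subrKA (picard (iterate n) x a)).
apply: le_trans (ler_normD _ _) _.
have -> : 2 * (K * w x) * q ^+ n = K * q ^+ n * w x + K * q ^+ n * w x by ring.
rewrite lerD//; last exact: le_trans H2 H3.
by rewrite distrC; exact: le_trans H1 H4.
Qed.

(** Finiteness of the weighted supremum provides b; conversely b gives integrability
    through [fuY_integrable]. *)
Lemma sfpe_solutionP (v : X -> A -> R) :
  sfpe_solution P w f (Y theta0) v <-> exists b, solves v b.
Proof.
split=> [[mv vb vi ve]|[b [mv b0 vb ve]]].
- set S := ereal_sup _ in vb.
  have Sub y : ((supnorm (v y) / w y)%:E <= S)%E.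
    by apply: ereal_sup_ubound; exists y.
  exists `|fine S|; split=> //.
  + by move=> a; exact: (measurable_coord a mv).
  + move=> x; rewrite -ler_pdivrMr//.
    move: Sub vb; case: S => [r| |] //= Sub _; last by have := Sub x.
    by apply: le_trans (ler_norm _); rewrite -lee_fin.
  + by move=> x a; move: (ve x a); rewrite unlock /Rintegral => <-.
- split.
  + exact: measurable_to_prod.
  + apply: (@le_lt_trans _ _ b%:E); last exact: ltry.
    apply: ge_ereal_sup => _ [y _ <-].
    by rewrite lee_fin ler_pdivrMr.
  + move=> x a; rewrite unlock.
    have /integrableP[_] := fuY_integrable x a mv b0 vb.
    exact.
  + move=> x a; rewrite unlock ve /Rintegral fineK//.
    exact: integrable_fin_num (fuY_integrable x a mv b0 vb).
Qed.

Lemma sfpe_solution_solves (v : X -> A -> R) :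
  sfpe_solution P w f (Y theta0) v -> solves v K.
Proof.
move=> /sfpe_solutionP[b sv]; have [mv _ _ ve] := sv; split => //.
  by rewrite divr_ge0// subr_ge0 ltW.
exact: solves_bound sv.
Qed.

Lemma sfpe_exists_unique : exists! v : X -> (A -> R), sfpe_solution P w f (Y theta0) v.
Proof.
have [v sv] := solves_exists; exists v; split.
  by apply/sfpe_solutionP; exists K.
by move=> u /sfpe_solution_solves su; exact: solves_unique sv su.
Qed.

End fixed_point.

(** * Error analysis *)

Variables (v : X -> A -> R) (B : R).
Hypothesis vm : forall a, measurable_fun [set: X] (v ^~ a).
Hypothesis B0 : 0 <= B.
Hypothesis vB : forall x, supnorm (v x) <= B * w x.
Hypothesis vE : forall x a,
  v x a = \int[P]_om f (Y theta0 x om a) (v (Y theta0 x om a)).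

Definition err n th (x : X) om : R := supnorm (fun a => V n th x om a - v x a).

Lemma err_field n th : measurable_fun [set: X * blk (desc th)]
  (fun p : X * blk (desc th) => err n th p.1 p.2).
Proof.
apply: (@measurable_supnorm R A _ (X * blk (desc th))%type
  (fun p a => V n th p.1 p.2 a - v p.1 a)) => a.
apply: measurable_funB; first exact: V_jointly_measurable.
exact: (measurableT_comp (vm a) measurable_fst).
Qed.

Lemma field_blockT (S : set Theta) (h : X -> Omega -> R) x :
  measurable_fun [set: X * blk S] (fun p : X * blk S => h p.1 p.2) ->
  measurable_fun [set: Omega] (h x).
Proof.
by move=> mh; apply: (measurable_blockT Fsub (S := S)); exact: field_section.
Qed.

Lemma field_comp_measurable (S : set Theta) (h : X -> Omega -> R) th x a :
  measurable_fun [set: X * blk S] (fun p : X * blk S => h p.1 p.2) ->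
  measurable_fun [set: Omega] (fun om => h (Y th x om a) om).
Proof.
move=> mh.
apply: (field_blockT (S := S `|` [set th]) (h := fun x om => h (Y th x om a) om)).
apply: (field_comp a (h := h)); first by right.
by apply: (field_mono (h := h) _ mh) => t; left.
Qed.

Lemma fv_measurable : measurable_fun [set: X] (fun x => f x (v x)).
Proof. exact: fu_measurable vm. Qed.

Lemma fvY_L2 th x a :
  L2le P (fun om => f (Y th x om a) (v (Y th x om a)))
    (kappa * w x + L * B * (lam * w x)).
Proof. exact: fuY_L2. Qed.

Lemma fV_fv n th y om : `|fV n th y om - f y (v y)| <= L * err n th y om.
Proof. exact: fLip. Qed.

(** A level n with error bound e, evaluated at Y^th for an index th outside the
    subtree that drives V_n^th'. *)
Section coupled.
Variables (n : nat) (e : R).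
Hypothesis e0 : 0 <= e.
Hypothesis errn : forall th x, L2le P (err n th x) (e * w x).
Variables (th th' : Theta).
Hypothesis dth : ~ desc th' th.

Lemma errY_measurable x a :
  measurable_fun [set: Omega] (fun om => err n th' (Y th x om a) om).
Proof. exact: (field_comp_measurable th x a (@err_field n th')). Qed.

Lemma errY_L2 x a :
  L2le P (fun om => err n th' (Y th x om a) om) (e * (lam * w x)).
Proof. exact: (L2le_field_comp x a dth (@err_field n th')). Qed.

Lemma fVY_measurable x a :
  measurable_fun [set: Omega] (fun om => fV n th' (Y th x om a) om).
Proof.
by apply: (field_comp_measurable th x a (h := fV n th')); apply: fV_field; exact: V_jointly_measurable.
Qed.

Lemma fVY_sub_fv_L2 x a :
  L2le P (fun om => fV n th' (Y th x om a) om - f (Y th x om a) (v (Y th x om a)))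
    (L * (e * (lam * w x))).
Proof.
have mE := errY_measurable x a.
have LW := L2le_scale L mE (errY_L2 x a).
apply: (L2le_le _ _ _ _ LW).
- apply: measurable_funB; first exact: fVY_measurable.
  exact: (measurableT_comp fv_measurable (Y_measurable th x a)).
- exact: measurable_funM.
- move=> om; rewrite (@ger0_norm _ (_ * _)); first exact: fV_fv.
  by rewrite mulr_ge0// supnorm_ge0.
- by rewrite lexx andbT !mulr_ge0// ltW.
Qed.

Lemma fVY_integrable x a :
  P.-integrable setT (fun om => (fV n th' (Y th x om a) om)%:E).
Proof.
have -> : (fun om => (fV n th' (Y th x om a) om)%:E) =
  (fun om => ((fV n th' (Y th x om a) om - f (Y th x om a) (v (Y th x om a)))%:E +
    (f (Y th x om a) (v (Y th x om a)))%:E)%E).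
  by apply/funext => om; rewrite -EFinD subrK.
have mfv := measurableT_comp fv_measurable (Y_measurable th x a).
apply: integrableD => //.
  apply: L2le_integrable (fVY_sub_fv_L2 x a).
  by apply: measurable_funB => //; exact: fVY_measurable.
exact: L2le_integrable (fvY_L2 th x a).
Qed.

(** Both sides are means at Y^th, of f(., V_n) and of f(., v). *)
Lemma fVY_bias x a :
  `|\int[P]_om fV n th' (Y th x om a) om - v x a| <= L * (e * (lam * w x)).
Proof.
have mfv := measurableT_comp fv_measurable (Y_measurable th x a).
rewrite vE -(mean_Y th x a fv_measurable) -RintegralB//; last 2 first.
- exact: fVY_integrable.
- exact: L2le_integrable (fvY_L2 th x a).
apply: L2le_mean.
- by apply: measurable_funB => //; exact: fVY_measurable.
- by rewrite !mulr_ge0// ltW.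
exact: fVY_sub_fv_L2.
Qed.

End coupled.

(** The mean of f(Y, V_n(Y)) is the same for all independent pairs of indices;
    this is what makes the level means telescope. *)
Lemma fVY_mean n th1 th1' th2 th2' x a : ~ desc th1' th1 -> ~ desc th2' th2 ->
  \int[P]_om fV n th1' (Y th1 x om a) om = \int[P]_om fV n th2' (Y th2 x om a) om.
Proof.
move=> d1 d2; rewrite /Rintegral; congr fine.
have H := field_comp_law d1 d2 (fV_field (@V_jointly_measurable n)) (fV_field (@V_jointly_measurable n))
  (fV_law th1' th2' (@V_same_law n)).
pose phi (u : prod_space (X * A) (measurableTypeR R)) := (u (x, a) : R)%:E.
have mphi : measurable_fun setT phi.
  by apply/measurable_EFinP; exact: measurable_eval.
exact: (eqlaw_integral mphi H).
Qed.

Hypothesis M0 : (0 < M)%N.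

Lemma not_desc_self th : ~ desc th th.
Proof. exact: desc_size. Qed.

Lemma not_desc_ext th l i l' i' : ~ desc (theta_ext th l i) (theta_ext th l' i').
Proof. by apply: desc_size; rewrite !size_ext. Qed.

Lemma V0 th x om a : V 0 th x om a = 0.
Proof. by rewrite hV big_geq. Qed.

Lemma err0_L2 th x : L2le P (err 0 th x) (B * w x).
Proof.
have -> : err 0 th x = cst (supnorm (v x)).
  apply/funext => om; rewrite /err /supnorm; apply: eq_bigr => a _.
  by rewrite V0 sub0r normrN.
by apply: L2le_cst; rewrite supnorm_ge0 vB.
Qed.

Definition mean_fV l x a : R := \int[P]_om fV l theta0 (Y theta0 x om a) om.

Lemma sample_measurable l th i x a :
  measurable_fun [set: blk (term_set th l i)] (fun om => sample l th i x om a).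
Proof.
apply: (field_section (h := fun x om => sample l th i x om a)).
by apply: sample_field; exact: V_jointly_measurable.
Qed.

(** Relative to w(x), an L2 bound for one sample at level l when e bounds the
    errors of the levels. *)
Definition sample_bound (e : nat -> R) l : R :=
  if l is l'.+1 then L * lam * (e l + e l') else kappa.

Section induction_step.
Variables (n : nat) (e : nat -> R).
Hypothesis n0 : (0 < n)%N.
Hypothesis e0 : forall l, 0 <= e l.
Hypothesis erre : forall l, (l < n)%N -> forall th x, L2le P (err l th x) (e l * w x).

Lemma sample_bound_ge0 l : 0 <= sample_bound e l.
Proof. by case: l => [|l] //=; rewrite !mulr_ge0// addr_ge0. Qed.

(** At level 0 the sample is f(Y, 0). At positive levels insert f(Y, v(Y)) between
    the two terms of the increment. *)
Lemma sample_L2 l th i x a : (l < n)%N ->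
  L2le P (fun om => sample l th i x om a) (sample_bound e l * w x).
Proof.
case: l => [|l] ln.
  have -> : (fun om => sample 0 th i x om a) =
      (fun om => f (Y (theta_ext th 0%N i) x om a) (fun=> 0)).
    apply/funext => om; rewrite /sample /increment mul0r subr0 /fV.
    by congr f; apply/funext => b; rewrite V0.
  exact: f0Y_L2.
set th1 := theta_ext th l.+1%:Z i%:Z; set th2 := theta_ext th (- l.+1%:Z) i%:Z.
have d1 : ~ desc th1 th1 by exact: not_desc_self.
have d2 : ~ desc th2 th1 by exact: not_desc_ext.
have E1 := L2le_scale L (errY_measurable l.+1 th1 th1 x a)
  (errY_L2 (e0 l.+1) (erre ln) d1 x a).
have E2 := L2le_scale L (errY_measurable l th1 th2 x a)
  (errY_L2 (e0 l) (erre (ltnW ln)) d2 x a).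
have m1 : measurable_fun setT (fun om => L * err l.+1 th1 (Y th1 x om a) om).
  by apply: measurable_funM => //; exact: errY_measurable.
have m2 : measurable_fun setT (fun om => L * err l th2 (Y th1 x om a) om).
  by apply: measurable_funM => //; exact: errY_measurable.
have b1 : 0 <= L * (e l.+1 * (lam * w x)) by rewrite !mulr_ge0// ltW.
have b2 : 0 <= L * (e l * (lam * w x)) by rewrite !mulr_ge0// ltW.
apply: (L2le_le _ _ _ _ (L2le_add m1 m2 b1 b2 E1 E2)).
- by apply: (measurable_blockT Fsub (S := term_set th l.+1 i)); exact: sample_measurable.
- exact: measurable_funD.
- move=> om; rewrite [leRHS]ger0_norm; last first.
    by rewrite addr_ge0// mulr_ge0// supnorm_ge0.
  rewrite /sample /increment -/th1 -/th2 mul1r; set y := Y th1 x om a.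
  rewrite -[X in `|X| <= _]addr0 -[X in _ + X](addNr (f y (v y))) addrACA.
  apply: le_trans (ler_normD _ _) _.
  by rewrite lerD ?fV_fv// -normrN opprD opprK fV_fv.
- rewrite addr_ge0//= le_eqVlt; apply/orP; left; apply/eqP; rewrite /=; ring.
Qed.

Lemma sample_mean l th i x a : (l < n)%N ->
  \int[P]_om sample l th i x om a = mean_fV l x a - (0 < l)%N%:R * mean_fV l.-1 x a.
Proof.
move=> ln; set th1 := theta_ext th l%:Z i%:Z; set th2 := theta_ext th (- l%:Z) i%:Z.
have d0 := @not_desc_self theta0.
have d1 : ~ desc th1 th1 by exact: not_desc_self.
have d2 : ~ desc th2 th1 by exact: not_desc_ext.
have ln' : (l.-1 < n)%N by rewrite (leq_ltn_trans (leq_pred _)).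
have i1 := fVY_integrable (e0 l) (erre ln) d1 x a.
have i2 := fVY_integrable (e0 l.-1) (erre ln') d2 x a.
rewrite /sample /increment -/th1 -/th2 RintegralB//; last first.
  exact: (integrableZl measurableT (0 < l)%N%:R i2).
rewrite RintegralZl//; congr (_ - _ * _); exact: fVY_mean.
Qed.

(** The recursion for the errors: bias of the previous level plus, for each a and
    each level, the Monte Carlo error of that level. *)
Lemma error_step th x : L2le P (err n th x)
  ((L * lam * e n.-1 + #|A|%:R *
    \sum_(0 <= l < n) sample_bound e l / Num.sqrt (M ^ (n - l))%:R) * w x).
Proof.
pose m l := (M ^ (n - l))%N.
have m0 l : (0 < m l)%N by rewrite expn_gt0 M0.
pose smp l i a om := sample l th i x om a.
pose D l a om := (m l)%:R^-1 *
  \sum_(1 <= i < (m l).+1) (smp l i a om - \int[P]_w smp l i a w).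
pose bias := L * lam * e n.-1 * w x.
have biasE : L * (e n.-1 * (lam * w x)) = bias by rewrite /bias; ring.
have bias0 : 0 <= bias by rewrite !mulr_ge0// ltW.
have mD l a : measurable_fun setT (D l a).
  apply: measurable_funM => //; apply: measurable_sum => i.
  apply: measurable_funB => //.
  by apply: (measurable_blockT Fsub (S := term_set th l i)); exact: sample_measurable.
have mDn l a : measurable_fun setT (fun om => `|D l a om|).
  exact: measurableT_comp.
have L2D l a : (l < n)%N ->
    L2le P (fun om => `|D l a om|) (sample_bound e l * w x / Num.sqrt (m l)%:R).
  move=> ln; have sw0 : 0 <= sample_bound e l * w x.
    by rewrite mulr_ge0 ?sample_bound_ge0// ltW.
  have sz : size (index_iota 1 (m l).+1) = m l by rewrite size_iota subn1.
  have H : L2le P (D l a) (sample_bound e l * w x / Num.sqrt (m l)%:R).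
    have := L2_average Fsub Find (s := index_iota 1 (m l).+1)
      (S := fun i => term_set th l i) (Z := fun i => smp l i a)
      (b := sample_bound e l * w x).
    rewrite sz; apply => //.
    - exact: iota_uniq.
    - by move=> i j _ _ ij; apply: term_set_disj; apply: contra ij => /eqP[->].
    - by move=> i _; exact: sample_measurable.
    - by move=> i _; exact: sample_L2.
  apply: (L2le_le (mDn l a) (mD l a) _ _ H); first by move=> om; rewrite normr_id.
  by rewrite lexx andbT divr_ge0 ?sqrtr_ge0.
(* The bias does not depend on om, and D l a is the centred Monte Carlo sum of level
   l; the level means telescope to the mean of level n - 1. *)
have decomp om a : V n th x om a - v x a =
    (mean_fV n.-1 x a - v x a) + \sum_(0 <= l < n) D l a om.
  have tele k : (k <= n)%N -> (0 < k)%N -> \sum_(0 <= l < k) ((m l)%:R^-1 *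
      \sum_(1 <= i < (m l).+1) \int[P]_w smp l i a w) = mean_fV k.-1 x a.
    have one l : (l < n)%N -> (m l)%:R^-1 *
      \sum_(1 <= i < (m l).+1) \int[P]_w smp l i a w =
      mean_fV l x a - (0 < l)%N%:R * mean_fV l.-1 x a.
      move=> ln; under eq_bigr do rewrite /smp sample_mean//.
      rewrite sumr_const_nat subn1 -[X in _ * X]mulr_natl mulKf//.
      by rewrite pnatr_eq0 -lt0n.
    elim: k => // -[_ kn _|k IH kn _].
      by rewrite big_nat1 one//= mul0r subr0.
    by rewrite big_nat_recr//= (IH (ltnW kn))// one// mul1r addrC subrK.
  rewrite V_sample.
  have -> : \sum_(0 <= l < n) (M ^ (n - l))%:R^-1 *
      \sum_(1 <= i < (M ^ (n - l)).+1) sample l th i x om a =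
    \sum_(0 <= l < n) ((m l)%:R^-1 * \sum_(1 <= i < (m l).+1) \int[P]_w smp l i a w
      + D l a om).
    apply: eq_bigr => l _; rewrite /D -mulrDr -big_split/=; congr (_ * _).
    by apply: eq_bigr => i _; rewrite addrC subrK.
  by rewrite big_split/= tele// addrAC.
have mS a : measurable_fun setT (fun om => \sum_(0 <= l < n) `|D l a om|).
  by apply: measurable_sum => l.
have mSS : measurable_fun setT (fun om => \sum_a \sum_(0 <= l < n) `|D l a om|).
  exact: measurable_sum.
pose s := \sum_(0 <= l < n) sample_bound e l * w x / Num.sqrt (m l)%:R.
have s0 : 0 <= s.
  apply: sumr_ge0 => l _; rewrite divr_ge0 ?sqrtr_ge0// mulr_ge0 ?sample_bound_ge0//.
  exact: ltW.
have L2S a : L2le P (fun om => \sum_(0 <= l < n) `|D l a om|) s.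
  apply: L2le_sum => l; rewrite mem_index_iota => ln; first exact: mDn.
    by rewrite divr_ge0 ?sqrtr_ge0// mulr_ge0 ?sample_bound_ge0// ltW.
  exact: L2D.
have L2SS : L2le P (fun om => \sum_a \sum_(0 <= l < n) `|D l a om|) (\sum_(a : A) s).
  exact: L2le_sum.
have L2b : L2le P (cst bias) bias.
  by apply: L2le_cst; rewrite bias0 lexx.
have ss0 : 0 <= \sum_(a : A) s by exact: sumr_ge0.
apply: (L2le_le _ _ _ _ (L2le_add _ mSS bias0 ss0 L2b L2SS)) => //.
- exact: field_blockT (@err_field n th).
- exact: measurable_funD.
- move=> om; rewrite ger0_norm ?supnorm_ge0// [leRHS]ger0_norm; last first.
    by rewrite addr_ge0//; apply: sumr_ge0 => a _; exact: sumr_ge0.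
  apply: supnorm_le => [|a].
    by rewrite addr_ge0//; apply: sumr_ge0 => a _; exact: sumr_ge0.
  rewrite decomp; apply: le_trans (ler_normD _ _) _; rewrite lerD//.
    have := fVY_bias (e0 n.-1) (erre _) (@not_desc_self theta0) x a.
    by rewrite prednK// biasE => /(_ (leqnn _)).
  apply: le_trans (ler_norm_sum _ _ _) _.
  by rewrite [leRHS](bigD1 a)//= lerDl sumr_ge0// => b _; exact: sumr_ge0.
- rewrite addr_ge0//= le_eqVlt; apply/orP; left; apply/eqP.
  rewrite sumr_const -[s *+ _]mulr_natl mulrDl -/bias; congr (_ + _).
  rewrite -[RHS]mulrA; congr (_ * _).
  by rewrite /s mulr_suml; apply: eq_bigr => l _; rewrite mulrAC.
Qed.

End induction_step.

(** The geometric sequence K rho^l is propagated through [error_step] by strong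
    induction, starting from V_0 = 0 and |v| <= B w. *)
Lemma error_rate (q rho K : R) : L * lam <= q -> 0 < rho -> B <= K ->
  (forall n, (0 < n)%N ->
    q * (K * rho ^+ n.-1) + #|A|%:R * \sum_(0 <= l < n)
      (if l is l'.+1 then q * (K * rho ^+ l + K * rho ^+ l') else kappa)
        / Num.sqrt (M ^ (n - l))%:R <= K * rho ^+ n) ->
  forall n th x, L2le P (err n th x) (K * rho ^+ n * w x).
Proof.
move=> Lq rho0 BK step; have K0 := le_trans B0 BK.
have e0 l : 0 <= K * rho ^+ l by rewrite mulr_ge0// exprn_ge0// ltW.
have merr n th x : measurable_fun setT (err n th x).
  exact: field_blockT (@err_field n th).
elim/ltn_ind => -[_|n IH] th x.
  apply: (L2le_le (merr _ _ _) (merr _ _ _) _ _ (err0_L2 th x)) => //.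
  by rewrite mulr1 mulr_ge0 ?(ltW (w0 x))//= ler_wpM2r// ltW.
apply: (L2le_le (merr _ _ _) (merr _ _ _) _ _
  (error_step (e := fun l => K * rho ^+ l) (ltn0Sn n) e0 IH th x)) => //.
have S0 : 0 <= \sum_(0 <= l < n.+1)
    sample_bound (fun l => K * rho ^+ l) l / Num.sqrt (M ^ (n.+1 - l))%:R.
  by apply: sumr_ge0 => l _; rewrite divr_ge0 ?sqrtr_ge0// sample_bound_ge0.
apply/andP; split.
  apply: mulr_ge0; last exact: ltW.
  by rewrite addr_ge0 ?(mulr_ge0 (mulr_ge0 L0 lam0))// mulr_ge0.
rewrite ler_wpM2r ?(ltW (w0 x))//; apply: le_trans (step _ (ltn0Sn n)).
rewrite lerD ?ler_wpM2r// ler_wpM2l//; apply: ler_sum_nat => -[|l] _ //.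
by rewrite ler_wpM2r ?invr_ge0 ?sqrtr_ge0//= ler_wpM2r// addr_ge0.
Qed.
End multilevel_picard.

(** * Rates *)

Section numerics.
Context (R : realType).

Lemma sum_geometric_mix (m rho : R) n : 0 <= m -> m < rho ->
  \sum_(0 <= l < n) rho ^+ l * m ^+ (n - l) <= rho ^+ n * (m / (rho - m)).
Proof.
move=> m0 mr; have rm : 0 < rho - m by rewrite subr_gt0.
have r0 : 0 <= rho by apply: le_trans m0 (ltW mr).
elim: n => [|n IH].
  by rewrite big_geq// mul1r divr_ge0// ltW.
rewrite big_nat_recr//= subSnn expr1.
have -> : \sum_(0 <= l < n) rho ^+ l * m ^+ (n.+1 - l) =
    m * \sum_(0 <= l < n) rho ^+ l * m ^+ (n - l).
  rewrite mulr_sumr; apply: eq_big_nat => l /andP[_ ln].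
  by rewrite subSn ?exprS 1?ltnW// mulrCA.
apply: (@le_trans _ _ (m * (rho ^+ n * (m / (rho - m))) + rho ^+ n * m)).
  by rewrite lerD2r ler_wpM2l.
rewrite exprS le_eqVlt; apply/orP; left; apply/eqP.
by field; rewrite gt_eqF.
Qed.

Lemma sqrt_natX (M k : nat) : Num.sqrt (M ^ k)%:R = Num.sqrt M%:R ^+ k :> R.
Proof.
elim: k => [|k IH]; first by rewrite expn0 sqrtr1 expr0.
by rewrite expnS natrM sqrtrM ?ler0n// IH exprS.
Qed.

(** With m = M^(-1/2), the hypothesis on M says t > 0, where t is the value at
    rho = 1 of (rho - q)(rho - m) - N q m (rho + 1). The derivative of this
    polynomial is at most 2 on [0, 1], so it is still positive at
    rho = 1 - t / 4, which is exactly the condition G < 1 that lets a geometric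
    sequence of ratio rho satisfy the recursion. *)
Lemma contraction_rate (M N : nat) (q kappa : R) :
  (0 < M)%N -> (0 < N)%N -> 0 <= kappa -> 0 <= q < 1 ->
  (1 + q * (2 * N%:R - 1)) ^+ 2 / (1 - q) ^+ 2 < M%:R ->
  exists rho K : R, [/\ 0 < rho < 1, 1 <= K, kappa / (1 - q) <= K &
    forall n, (0 < n)%N ->
      q * (K * rho ^+ n.-1) + N%:R * \sum_(0 <= l < n)
        (if l is l'.+1 then q * (K * rho ^+ l + K * rho ^+ l') else kappa)
          / Num.sqrt (M ^ (n - l))%:R <= K * rho ^+ n].
Proof.
move=> M0 N0 k0 /andP[q0 q1] Mbig.
have q1' : 0 < 1 - q by rewrite subr_gt0.
have N1 : 1 <= N%:R :> R by rewrite ler1n.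
have M0' : 0 < M%:R :> R by rewrite ltr0n.
pose s := Num.sqrt M%:R : R.
have s0 : 0 < s by rewrite sqrtr_gt0.
have ss : s ^+ 2 = M%:R by rewrite sqr_sqrtr// ltW.
have num0 : 0 < 1 + q * (2 * N%:R - 1) by nra.
have sbig : 1 + q * (2 * N%:R - 1) < s * (1 - q).
  have : (1 + q * (2 * N%:R - 1)) ^+ 2 < (s * (1 - q)) ^+ 2.
    by rewrite exprMn ss -ltr_pdivrMr// exprn_gt0.
  by rewrite ltr_pXn2r// nnegrE ltW// mulr_gt0.
pose m := s^-1.
have m0 : 0 < m by rewrite invr_gt0.
have msE : m * s = 1 by rewrite mulVf// gt_eqF.
pose t := (1 - q) * (1 - m) - 2 * N%:R * q * m.
have t0 : 0 < t.
  have : m * (1 + q * (2 * N%:R - 1)) < m * (s * (1 - q)) by rewrite ltr_pM2l.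
  by rewrite mulrA msE mul1r /t; nra.
have m1 : m < 1.
  have : m * (1 + q * (2 * N%:R - 1)) < m * (s * (1 - q)) by rewrite ltr_pM2l.
  rewrite mulrA msE mul1r => H; have := mulr_ge0 q0 (ltW m0).
  nra.
have tm : t <= 1 - m.
  have : 0 <= 2 * N%:R * q * m by rewrite !mulr_ge0// ltW.
  have : 0 <= q * (1 - m) by rewrite mulr_ge0// subr_ge0 ltW.
  by rewrite /t; nra.
pose rho := 1 - t / 4.
have rho1 : rho < 1 by rewrite /rho; lra.
have rhom : m < rho by rewrite /rho; lra.
have rho0 : 0 < rho by apply: lt_trans m0 rhom.
have rm0 : 0 < rho - m by rewrite subr_gt0.
have Hrho : q * (rho - m) + N%:R * q * m * (rho + 1) < rho * (rho - m).
  have Nqm : 0 <= N%:R * q * m by rewrite !mulr_ge0// ltW.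
  have E : rho * (rho - m) - q * (rho - m) - N%:R * q * m * (rho + 1) =
    t - t / 4 * (2 - q - m) + (t / 4) ^+ 2 + N%:R * q * m * (t / 4).
    by rewrite /rho /t; field.
  have t4 : 0 < t / 4 by lra.
  have := mulr_ge0 Nqm (ltW t4); have := sqr_ge0 (t / 4).
  have := mulr_ge0 (ltW t4) (addr_ge0 q0 (ltW m0)).
  nra.
pose G := q / rho + N%:R * q * (1 + rho^-1) * (m / (rho - m)).
have G1 : G < 1.
  have -> : G = (q * (rho - m) + N%:R * q * m * (rho + 1)) / (rho * (rho - m)).
    by rewrite /G; field; rewrite !gt_eqF.
  by rewrite ltr_pdivrMr ?mul1r// mulr_gt0.
have G1' : 0 < 1 - G by rewrite subr_gt0.
(* The first summand absorbs the level 0 term N kappa m^n, the second dominates the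
   norm of the fixed point, the third makes log K nonnegative. *)
pose K := N%:R * kappa / (1 - G) + kappa / (1 - q) + 1.
have a0 : 0 <= N%:R * kappa / (1 - G) by rewrite divr_ge0 ?mulr_ge0// ltW.
have b0 : 0 <= kappa / (1 - q) by rewrite divr_ge0// ltW.
have K1 : 1 <= K by rewrite /K; lra.
have K0 : 0 <= K by exact: le_trans K1.
exists rho, K; split; [by rewrite rho0|exact: K1|by rewrite /K; lra|].
move=> n n0.
have KG : K * G + N%:R * kappa <= K.
  have : N%:R * kappa <= K * (1 - G).
    by rewrite -ler_pdivrMr// /K; lra.
  by rewrite mulrBr mulr1; lra.
have sum_le : \sum_(0 <= l < n)
        (if l is l'.+1 then q * (K * rho ^+ l + K * rho ^+ l') else kappa)
          / Num.sqrt (M ^ (n - l))%:R <=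
    kappa * m ^+ n + q * K * (1 + rho^-1) * (rho ^+ n * (m / (rho - m))).
  have c0 : 0 <= q * K * (1 + rho^-1).
    by rewrite !mulr_ge0// addr_ge0// invr_ge0 ltW.
  apply: (@le_trans _ _ (kappa * m ^+ n +
    \sum_(0 <= l < n) q * K * (1 + rho^-1) * (rho ^+ l * m ^+ (n - l)))).
    case: n n0 => // n _; rewrite !big_nat_recl//= subn0 addrA lerD//.
      rewrite sqrt_natX -exprVn -/s -/m lerDl mulr_ge0// mulr_ge0 ?expr0//.
      by rewrite exprn_ge0// ltW.
    apply: ler_sum_nat => l _; rewrite sqrt_natX -exprVn -/s -/m.
    rewrite le_eqVlt; apply/orP; left; apply/eqP; rewrite [rho ^+ l.+1]exprS.
    by field; rewrite gt_eqF.
  by rewrite lerD2l -mulr_sumr ler_wpM2l// sum_geometric_mix// ltW.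
have rn : rho ^+ n = rho * rho ^+ n.-1 by rewrite -exprS prednK.
have mn : m ^+ n <= rho ^+ n by rewrite lerXn2r// ?nnegrE ltW.
apply: (@le_trans _ _ (q * (K * rho ^+ n.-1) + N%:R * (kappa * rho ^+ n +
   q * K * (1 + rho^-1) * (rho ^+ n * (m / (rho - m)))))).
  rewrite lerD2l ler_wpM2l//; apply: le_trans sum_le _.
  by rewrite lerD2r ler_wpM2l.
have -> : q * (K * rho ^+ n.-1) + N%:R * (kappa * rho ^+ n +
   q * K * (1 + rho^-1) * (rho ^+ n * (m / (rho - m)))) =
   (K * G + N%:R * kappa) * rho ^+ n.
  by rewrite rn /G; field; rewrite !gt_eqF.
by rewrite ler_wpM2r// exprn_ge0// ltW.
Qed.

(** Each of the three terms at level l is at most c (4M)^l, and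
    3 (1/4 + 1/16 + ...) = 1 closes the induction. *)
Lemma cost_bound (M : nat) (C : nat -> R) (c : R) : (0 < M)%N -> 0 <= c ->
  (forall n, C n <= \sum_(0 <= l < n) (M ^ (n - l))%:R *
     (c + C l + (0 < l)%N%:R * C l.-1)) ->
  forall n, C n <= c * (4 * M%:R) ^+ n.
Proof.
move=> M0 c0 HC; elim/ltn_ind => n IH.
have M1 : 1 <= M%:R :> R by rewrite ler1n.
have g1 : 1 <= 4 * M%:R :> R by lra.
apply: le_trans (HC n) _.
apply: (@le_trans _ _ (3 * c * \sum_(0 <= l < n) (4 * M%:R) ^+ l * M%:R ^+ (n - l))).
  rewrite mulr_sumr; apply: ler_sum_nat => l /andP[_ ln].
  have gl : 1 <= (4 * M%:R) ^+ l :> R by rewrite exprn_ege1.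
  have H1 : c <= c * (4 * M%:R) ^+ l by rewrite ler_peMr.
  have H2 : (0 < l)%N%:R * C l.-1 <= c * (4 * M%:R) ^+ l.
    case: l ln gl H1 => [|l] ln gl H1; first by rewrite mul0r; exact: le_trans H1.
    rewrite mul1r; apply: le_trans (IH _ (ltnW ln)) _.
    by rewrite ler_wpM2l// ler_weXn2l.
  have H3 := IH _ ln.
  have -> : 3 * c * ((4 * M%:R) ^+ l * M%:R ^+ (n - l)) =
    (M ^ (n - l))%:R * (3 * (c * (4 * M%:R) ^+ l)) by rewrite natrX; ring.
  by rewrite ler_wpM2l//; lra.
apply: (@le_trans _ _ (3 * c * ((4 * M%:R) ^+ n * (M%:R / (4 * M%:R - M%:R))))).
  by rewrite ler_wpM2l ?mulr_ge0// sum_geometric_mix//; lra.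
rewrite le_eqVlt; apply/orP; left; apply/eqP; field.
by apply/eqP; lra.
Qed.

Lemma exprn_expR (a : R) n : 0 < a -> a ^+ n = expR (n%:R * ln a).
Proof. by move=> a0; rewrite -powR_mulrn ?ltW// /powR gt_eqF. Qed.

(** Take N(eps) to be one more than the integer part of the solution x of
    K rho^x = eps; then g^N is at most g times g^x, and g^x is a power of
    K / eps. *)
Lemma polynomial_complexity (rho K g : R) : 0 < rho < 1 -> 1 <= K -> 1 < g ->
  exists (N : R -> nat) (c : R), 0 <= c /\ forall eps, 0 < eps <= 1 ->
    [/\ (0 < N eps)%N, K * rho ^+ N eps <= eps & g ^+ N eps <= c * eps `^ (- c)].
Proof.
move=> /andP[rho0 rho1] K1 g1.
have K0 : 0 < K by exact: lt_le_trans K1.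
have g0 : 0 < g by exact: lt_trans g1.
pose r := - ln rho; pose a := ln g.
have r0 : 0 < r by rewrite oppr_gt0 ln_lt0// rho0.
have a0 : 0 < a by rewrite ln_gt0.
pose x eps := (ln K - ln eps) / r.
pose c := Num.max (a / r) (g * expR (a / r * ln K)).
have c0 : 0 <= c by rewrite le_max divr_ge0// ltW.
exists (fun eps => (Num.truncn (x eps)).+1), c; split => // eps /andP[e0 e1].
have lK : 0 <= ln K by rewrite ln_ge0.
have le0 : ln eps <= 0 by rewrite ln_le0.
have x0 : 0 <= x eps by rewrite divr_ge0 ?(ltW r0)// subr_ge0 (le_trans le0).
have /andP[xl xu] := truncn_itv x0.
set n := (Num.truncn (x eps)).+1 in xu *.
have xr : x eps * r = ln K - ln eps by rewrite /x divfK// gt_eqF.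
split => //.
  rewrite exprn_expR//.
  have -> : ln rho = - r by rewrite /r opprK.
  rewrite -[X in X * _]lnK ?posrE// -expRD -[leRHS]lnK ?posrE// ler_expR.
  have : x eps * r <= n%:R * r by rewrite ler_pM2r// ltW.
  by rewrite xr; lra.
rewrite exprn_expR// -/a.
have n1 : n%:R <= x eps + 1 by rewrite /n -natr1 lerD2r.
have ea : expR (n%:R * a) <= g * expR (a / r * ln K) * eps `^ (- (a / r)).
  rewrite /powR gt_eqF// -{1}(lnK (x := g)) ?posrE// -!expRD ler_expR -/a.
  have -> : a + a / r * ln K + - (a / r) * ln eps = (x eps + 1) * a.
    by rewrite /x; field; rewrite gt_eqF.
  by rewrite ler_pM2r.
apply: le_trans ea _; apply: ler_pM.
- by rewrite mulr_ge0 ?expR_ge0// ltW.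
- exact: powR_ge0.
- by rewrite /c le_max lexx orbT.
rewrite /powR gt_eqF// ler_expR.
have : a / r <= c by rewrite /c le_max lexx.
by nra.
Qed.

End numerics.

(** * The theorem *)

Lemma L2le_poweR (R : realType) d (T : measurableType d) (P : probability T R)
    (Z : T -> R) b : 0 <= b ->
  (poweR 'E_P[fun om => (`|Z om| ^+ 2)%R] 2^-1 <= b%:E)%E -> L2le P Z b.
Proof.
move=> b0; rewrite unlock /L2le.
under eq_integral do rewrite (real_normK (num_real _)).
have : (0 <= \int[P]_om (Z om ^+ 2)%:E)%E.
  by apply: integral_ge0 => om _; rewrite lee_fin sqr_ge0.
case: (\int[P]_om (Z om ^+ 2)%:E)%E => [r| |] //.
  rewrite lee_fin => r0; rewrite poweR_EFin !lee_fin powR12_sqrt// => rb.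
  by rewrite -(sqr_sqrtr r0) lerXn2r ?nnegrE ?sqrtr_ge0.
by rewrite poweRyr// invr_eq0 pnatr_eq0.
Qed.

Lemma sup_error_le (R : realType) d (T : measurableType d) (P : probability T R)
    (X : Type) (Z : X -> T -> R) (w : X -> R) e : (forall x, 0 < w x) -> 0 <= e ->
  (forall x, L2le P (Z x) (e * w x)) ->
  (ereal_sup [set poweR ('E_P[fun om => (Z x om ^+ 2)%R] / (`|w x| ^+ 2)%:E) 2^-1
             | x in [set: X]] <= e%:E)%E.
Proof.
move=> w0 e0 Ze; apply: ge_ereal_sup => _ [x _ <-].
have w2 : 0 < `|w x| ^+ 2 by rewrite exprn_gt0// normr_gt0 gt_eqF.
have E0 : (0 <= \int[P]_om (Z x om ^+ 2)%:E)%E.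
  by apply: integral_ge0 => om _; rewrite lee_fin sqr_ge0.
have := Ze x; rewrite /L2le unlock; move: E0.
case: (\int[P]_om (Z x om ^+ 2)%:E)%E => [r| |] //=; rewrite !lee_fin => r0 re.
rewrite inver gt_eqF// -EFinM poweR_EFin lee_fin powR12_sqrt; last first.
  by rewrite divr_ge0// ltW.
rewrite -(ger0_norm e0) -(sqrtr_sqr e) ler_wsqrtr// ler_pdivrMr//.
by rewrite (real_normK (num_real _)) -exprMn.
Qed.

Lemma ereal_sup_lt1 (R : realType) (D : Type) (g : D -> R) :
  [set: D] !=set0 -> (forall d, 0 <= g d) ->
  (ereal_sup [set (g d)%:E | d in [set: D]] < 1)%E ->
  let q := fine (ereal_sup [set (g d)%:E | d in [set: D]]) in
  0 <= q < 1 /\ forall d, g d <= q.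
Proof.
move=> [d0 _] g0; set S := ereal_sup _ => S1 /=.
have gS d : ((g d)%:E <= S)%E by apply: ereal_sup_ubound; exists d.
have Sf : S \is a fin_num.
  rewrite ge0_fin_numE; first by apply: lt_trans S1 _; exact: ltry.
  by apply: le_trans (gS d0); rewrite lee_fin.
move: gS S1; rewrite -(fineK Sf) lte_fin => gS S1.
rewrite S1 andbT; split=> [|d].
  by rewrite -lee_fin; apply: le_trans (gS d0); rewrite lee_fin.
by rewrite -lee_fin.
Qed.

Theorem theorem4p1 (R : realType) (M : nat) (hM : (0 < M)%N)
  (A : finType) (hA : (0 < #|A|)%N)
  (kappa : R) (hkappa : 0 <= kappa)
  (D : Type) (hD : [set: D] !=set0)
  (lam L Rc : D -> R)
  (hlam : forall d, 0 <= lam d) (hL : forall d, 0 <= L d)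
  (hRc : forall d, 0 <= Rc d)
  (dO : measure_display) (Omega : measurableType dO) (P : probability Omega R)
  (dX : D -> measure_display) (X : forall d : D, measurableType (dX d))
  (w : forall d : D, X d -> R)
  (hw0 : forall d x, 0 < w d x)
  (hwm : forall d, measurable_fun [set: X d] (w d))
  (f : forall d : D, X d -> (A -> R) -> R)
  (hfm : forall d, measurable_fun [set: X d * Rpow A R]
     (fun p : X d * Rpow A R => f d p.1 p.2))
  (F : D -> Theta -> set_system Omega)
  (hFsub : forall d th, sub_sigma_algebra_of (F d th))
  (hFind : forall d, independent_systems P (F d))
  (Y : forall d : D, Theta -> X d -> Omega -> (A -> X d))
  (hYiid : forall d, iid_fields P
     (Y d : Theta -> X d -> Omega -> prod_space A (X d)))
  (hYm : forall d th,
     measurable_fun [set: X d * g_sigma_algebraType (F d th)]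
       (fun p : X d * g_sigma_algebraType (F d th) =>
          Y d th p.1 p.2 : prod_space A (X d)))
  (hfLip : forall d (x : X d) (r s : A -> R),
     `|f d x r - f d x s| <= L d * \big[Num.max/0]_(b : A) `|r b - s b|)
  (hf0 : forall d (x : X d) (a : A),
     (poweR 'E_P[fun om => (`|f d (Y d theta0 x om a) (fun=> 0%R)| ^+ 2)%R] 2^-1
        <= (kappa * w d x)%:E)%E)
  (hw : forall d (x : X d) (a : A),
     (poweR 'E_P[fun om => (`|w d (Y d theta0 x om a)| ^+ 2)%R] 2^-1
        <= (lam d * w d x)%:E)%E)
  (hsup : (ereal_sup [set (lam u * L u)%:E | u in [set: D]] < 1)%E)
  (hMlarge :
     let q : R := fine (ereal_sup [set (lam d * L d)%:E | d in [set: D]]) in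
     M%:R > (1 + q * (2 * #|A|%:R - 1)) ^+ 2 / (1 - q) ^+ 2)
  (V : forall d : D, nat -> Theta -> X d -> Omega -> (A -> R))
  (hV : forall d (n : nat) (x : X d) (a : A) (th : Theta) (om : Omega),
     V d n th x om a =
     \sum_(0 <= l < n) ((M ^ (n - l))%:R)^-1 *
       \sum_(1 <= i < (M ^ (n - l)).+1)
         (let y := Y d (theta_ext th l%:Z i%:Z) x om a in
          f d y (V d l (theta_ext th l%:Z i%:Z) y om)
          - (0 < l)%N%:R *
            f d y (V d (maxn (l - 1) 0) (theta_ext th (- l%:Z) i%:Z) y om)))
  (C : nat -> D -> R)
  (hC0 : forall n d, 0 <= C n d)
  (hC : forall n d,
     C n d <= \sum_(0 <= l < n) (M ^ (n - l))%:R *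
                (Rc d + C l d + (0 < l)%N%:R * C (maxn (l - 1) 0) d)) :
  (forall d : D, exists! v : X d -> (A -> R),
     sfpe_solution P (w d) (f d) (Y d theta0) v)
  /\
  (forall v : forall d : D, X d -> (A -> R),
     (forall d, sfpe_solution P (w d) (f d) (Y d theta0) (v d)) ->
     exists (N : R -> nat) (c : R),
       (forall eps, 0 < eps <= 1 -> (0 < N eps)%N) /\
       forall (d : D) (eps : R), 0 < eps <= 1 ->
         C (N eps) d <= c * Rc d * eps `^ (- c) /\
         (ereal_sup
            [set poweR ('E_P[fun om =>
                          (supnorm (fun a => v d x a
                             - V d (N eps) theta0 x om a) ^+ 2)%R]
                        / (`|w d x| ^+ 2)%:E) 2^-1
            | x in [set: X d]] <= eps%:E)%E).
Proof.
have g0 d : 0 <= lam d * L d by exact: mulr_ge0.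
have [q01 gq] := ereal_sup_lt1 hD g0 hsup.
set q := fine _ in hMlarge q01 gq.
have Lq d : L d * lam d <= q by rewrite mulrC.
have q1 d : L d * lam d < 1 by case/andP: q01 => _; exact: le_lt_trans.
have f0L2 d x a : L2le P (fun om => f d (Y d theta0 x om a) (fun=> 0)) (kappa * w d x).
  by apply: L2le_poweR => //; rewrite mulr_ge0// ltW.
have wL2 d x a : L2le P (fun om => w d (Y d theta0 x om a)) (lam d * w d x).
  by apply: L2le_poweR => //; rewrite mulr_ge0// ltW.
split=> [d|v sv].
  exact: (sfpe_exists_unique (hfm d) (hFsub d) (hYiid d) (hYm d)
    (hw0 d) (hwm d) hkappa (hlam d) (hL d) (hfLip d) (f0L2 d) (wL2 d) (q1 d)).
have [rho [K [rho01 K1 kK step]]] := contraction_rate hM hA hkappa q01 hMlarge.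
have M1 : 1 <= M%:R :> R by rewrite ler1n.
have g1 : 1 < 4 * M%:R :> R by lra.
have [N [c [c0 HN]]] := polynomial_complexity rho01 K1 g1.
exists N, c; split=> [eps /HN[]//|d eps eps01]; have [_ Keps geps] := HN _ eps01.
split.
  have H := @cost_bound R M (fun n => C n d) (Rc d) hM (hRc d).
  apply: le_trans (H _ (N eps)) _.
    move=> n; apply: le_trans (hC n d) _.
    by apply: ler_sum_nat => l _; rewrite maxn0 subn1.
  by rewrite mulrC -mulrA mulrCA mulrC; apply: ler_wpM2l.
have [vm B0 vB vE] := sfpe_solution_solves (hfm d) (hFsub d) (hYiid d) (hYm d)
  (hw0 d) (hwm d) hkappa (hlam d) (hL d) (hfLip d) (f0L2 d) (wL2 d) (q1 d) (sv d).
have /andP[rho0 _] := rho01.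
have BK : kappa / (1 - L d * lam d) <= K.
  apply: le_trans kK; rewrite ler_wpM2l// lef_pV2 ?posrE ?subr_gt0//.
    by rewrite lerD2l lerN2.
  by case/andP: q01.
have K0 : 0 <= K by exact: le_trans K1.
have e0 : 0 <= K * rho ^+ N eps by rewrite mulr_ge0// exprn_ge0// ltW.
have H := error_rate (hfm d) (hFsub d) (hFind d) (hYiid d) (hYm d) (hV d)
  (hw0 d) (hwm d) hkappa (hlam d) (hL d) (hfLip d) (f0L2 d) (wL2 d) vm B0 vB vE hM
  (Lq d) rho0 BK step (N eps) theta0.
have errE x : (fun om => supnorm (fun a => v d x a - V d (N eps) theta0 x om a)) =
    err (V d) (v d) (N eps) theta0 x.
  apply/funext => om; rewrite /err /supnorm; apply: eq_bigr => a _.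
  by rewrite distrC.
apply: (@le_trans _ _ (K * rho ^+ N eps)%:E); last by rewrite lee_fin.
apply: (sup_error_le (hw0 d) e0 (Z := fun x om =>
  supnorm (fun a => v d x a - V d (N eps) theta0 x om a))) => x.
by rewrite errE.
Qed.
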